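(* For every integer $k>1$, the group $BS(1,k)=\langle a,b\mid b^{-1}ab=a^k\rangle$ (in the group language $\{\cdot,{}^{-1},e\}$) and the ring of integers $\mathbb{Z}$ (in the ring language $\{+,\cdot,0,1\}$) are strongly regularly bi-interpretable.
   Context: All structures are algebraic structures in functional languages (function and constant symbols). For a structure $\mathbb{B}$ and a formula $\phi(\bar x,\bar y)$ of its language, $\phi(\mathbb{B},\bar p)$ denotes the set of tuples satisfying $\phi(\bar x,\bar p)$. Interpretation codes. Let $L_A,L_B$ be languages. A code $\Gamma$ (of an $L_A$-structure in $L_B$-structures) of dimension $n=\dim\Gamma$ and parameter dimension $k'=\dim_{par}\Gamma$ is a set of $L_B$-formulas $U_\Gamma(\bar x,\bar y)$, $E_\Gamma(\bar x,\bar x',\bar y)$, and for each symbol $Q\in L_A$ of arity $t_Q$ (constants have arity $0$) a formula $Q_\Gamma(\bar x_1,\dots,\bar x_{t_Q},\bar x_{t_Q+1},\bar y)$, where all $\bar x$'s are $n$-tuples and $|\bar y|=k'$. For an $L_B$-structure $\mathbb{B}$ and $\bar p\in B^{k'}$, $\Gamma(\mathbb{B},\bar p)$ is the $L_A$-structure (when this is well defined) whose universe is $U_\Gamma(\mathbb{B},\bar p)$ modulo the equivalence relation defined by $E_\Gamma(\cdot,\cdot,\bar p)$, where the graph of the interpretation of $Q$ is given by the preimage $Q_\Gamma(\mathbb{B},\bar p)$. An $L_A$-structure $\mathbb{A}$ is interpreted in $\mathbb{B}$ by $(\Gamma,\bar p)$ if $\Gamma(\mathbb{B},\bar p)$ is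 well defined and isomorphic to $\mathbb{A}$; a coordinate map is then a surjection $\mu:U_\Gamma(\mathbb{B},\bar p)\to A$ inducing an isomorphism $\Gamma(\mathbb{B},\bar p)\to\mathbb{A}$ (it is applied coordinatewise to tuples). The interpretation is absolute if $k'=0$. A regular interpretation $(\Gamma,\phi)$ of $\mathbb{A}$ in $\mathbb{B}$ is a code $\Gamma$ together with an $L_B$-formula $\phi(\bar y)$ such that $\phi(\mathbb{B})\neq\emptyset$ and $\Gamma(\mathbb{B},\bar p)\cong\mathbb{A}$ for every $\bar p\in\phi(\mathbb{B})$. Translation and composition. For each $L_A$-formula $\chi(x_1,\dots,x_m)$ there is an $L_B$-formula $\chi_\Gamma(\bar x_1,\dots,\bar x_m,\bar y)$ (obtained by replacing variables by $n$-tuples restricted to $U_\Gamma$, equality by $E_\Gamma$ and symbols by the $Q_\Gamma$) such that whenever $\mathbb{A}\cong\Gamma(\mathbb{B},\bar p)$ with coordinate map $\mu$, for all $\bar b_i\in U_\Gamma(\mathbb{B},\bar p)$: $\mathbb{A}\models\chi(\mu(\bar b_1),\dots,\mu(\bar b_m))\iff\mathbb{B}\models\chi_\Gamma(\bar b_1,\dots,\bar b_m,\bar p)$. If $\Gamma$ is a code of $L_A$-structures in $L_B$-structures and $\Delta$ a code of $L_B$-structures in $L_C$-structures, the composition $\Gamma\circ\Delta$ is the code $\{(U_\Gamma)_\Delta,(E_\Gamma)_\Delta,(Q_\Gamma)_\Delta: Q\in L_A\}$ (all free variables of $\Gamma$'s formulas, including the parameter variables, replaced by $\dim\Delta$-tuples,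 plus the parameter variables of $\Delta$); $\dim\Gamma\circ\Delta=\dim\Gamma\cdot\dim\Delta$ and $\dim_{par}\Gamma\circ\Delta=\dim_{par}\Gamma\cdot\dim\Delta+\dim_{par}\Delta$. If $\mathbb{A}\cong\Gamma(\mathbb{B},\bar p)$ with coordinate map $\mu_\Gamma$ and $\mathbb{B}\cong\Delta(\mathbb{C},\bar q)$ with coordinate map $\mu_\Delta$, and $\bar{\bar p}\in\mu_\Delta^{-1}(\bar p)$, then $\mathbb{A}\cong\Gamma\circ\Delta(\mathbb{C},(\bar{\bar p},\bar q))$ with coordinate map $\mu_\Gamma\circ\mu_\Delta$ (apply $\mu_\Delta$ to each block, then $\mu_\Gamma$); if $(\Gamma,\phi),(\Delta,\psi)$ are regular then $(\Gamma\circ\Delta,\phi_\Delta\wedge\psi)$ is regular. Strong regular bi-interpretability. Structures $\mathbb{A},\mathbb{B}$ are strongly regularly bi-interpretable if: (1) there are a regular interpretation $(\Gamma,\phi)$ of $\mathbb{A}$ in $\mathbb{B}$ and a regular interpretation $(\Delta,\psi)$ of $\mathbb{B}$ in $\mathbb{A}$; (2) there is an $L_A$-formula $\theta_{\mathbb{A}}(\bar u,x,\bar r)$, $|\bar u|=\dim\Gamma\cdot\dim\Delta$, $|\bar r|=\dim_{par}\Gamma\circ\Delta$, such that for every $\bar r_0\in(\phi_\Delta\wedge\psi)(\mathbb{A})$ the formula $\theta_{\mathbb{A}}(\bar u,x,\bar r_0)$ defines (the graph of) some coordinate map $U_{\Gamma\circ\Delta}(\mathbb{A},\bar r_0)\to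 A$; (3) there is an $L_B$-formula $\theta_{\mathbb{B}}(\bar u,x,\bar t)$, $|\bar t|=\dim_{par}\Delta\circ\Gamma$, such that for every $\bar t_0\in(\psi_\Gamma\wedge\phi)(\mathbb{B})$ the formula $\theta_{\mathbb{B}}(\bar u,x,\bar t_0)$ defines some coordinate map $U_{\Delta\circ\Gamma}(\mathbb{B},\bar t_0)\to B$; (4) for every $\bar p\in\phi(\mathbb{B})$ and $\bar q\in\psi(\mathbb{A})$ there are coordinate maps $\mu_\Gamma$ of $(\Gamma,\bar p)$ and $\mu_\Delta$ of $(\Delta,\bar q)$ such that for all $\bar r_0=(\bar{\bar p},\bar q)$ with $\bar{\bar p}\in\mu_\Delta^{-1}(\bar p)$ and all $\bar t_0=(\bar{\bar q},\bar p)$ with $\bar{\bar q}\in\mu_\Gamma^{-1}(\bar q)$, the maps $\mu_\Gamma\circ\mu_\Delta:U_{\Gamma\circ\Delta}(\mathbb{A},\bar r_0)\to A$ and $\mu_\Delta\circ\mu_\Gamma:U_{\Delta\circ\Gamma}(\mathbb{B},\bar t_0)\to B$ are defined by $\theta_{\mathbb{A}}(\bar u,x,\bar r_0)$ and $\theta_{\mathbb{B}}(\bar u,x,\bar t_0)$ respectively. *)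

(* Defs.v *)
From Stdlib Require Import ZArith.
From mathcomp Require Import all_boot.

Set Implicit Arguments.
Unset Strict Implicit.
Unset Printing Implicit Defensive.

Record language := Language { fsym : Type; arity : fsym -> nat }.

Record structure (L : language) := Structure {
  carrier :> Type;
  interp : forall f : fsym L, ('I_(arity f) -> carrier) -> carrier }.
Arguments interp {L} s f _.

Inductive term (L : language) : Type :=
  | Var : nat -> term L
  | App : forall f : fsym L, ('I_(arity f) -> term L) -> term L.

Inductive formula (L : language) : Type :=
  | FEq  : term L -> term L -> formula L
  | FNot : formula L -> formula L
  | FAnd : formula L -> formula L -> formula L
  | FOr  : formula L -> formula L -> formula L
  | FImp : formula L -> formula L -> formula L
  | FEx  : nat -> formula L -> formula L
  | FAll : nat -> formula L -> formula L.

Definition upd {T : Type} (v : nat -> T) (x : nat) (a : T) : nat -> T :=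
  fun i => if i == x then a else v i.

Section Semantics.
Variables (L : language) (M : structure L).

Fixpoint eval (v : nat -> M) (t : term L) : M :=
  match t with
  | Var i => v i
  | App f ts => interp M f (fun j => eval v (ts j))
  end.

Fixpoint sat (v : nat -> M) (phi : formula L) : Prop :=
  match phi with
  | FEq t1 t2 => eval v t1 = eval v t2
  | FNot p => ~ sat v p
  | FAnd p q => sat v p /\ sat v q
  | FOr p q => sat v p \/ sat v q
  | FImp p q => sat v p -> sat v q
  | FEx x p => exists a : M, sat (upd v x a) p
  | FAll x p => forall a : M, sat (upd v x a) p
  end.

(* M |= phi(s_0, ..., s_{m-1}): variable i is assigned s_i (any further
   free variables are read universally, i.e. as the universal closure). *)
Definition holds (phi : formula L) (s : seq M) : Prop :=
  forall v : nat -> M, (forall i, i < size s -> v i = nth (v i) s i) -> sat v phi.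

End Semantics.
Arguments eval {L} M v t.
Arguments sat {L} M v phi.
Arguments holds {L} M phi s.

Definition tseq {T : Type} {n : nat} (t : 'I_n -> T) : seq T := map t (enum 'I_n).

Definition ext {T : Type} {n : nat} (vs : 'I_n -> T) (u : T) : 'I_n.+1 -> T :=
  fun i => if unlift ord_max i is Some j then vs j else u.

(* Variable conventions (x's are blocks of dim variables, y's of pdim): *)
(*   cU    : x = vars 0..n-1, y = the next pdim variables               *)
(*   cE    : x, x', y consecutively                                     *)
(*   cQ Q  : x_1, ..., x_{t_Q}, x_{t_Q+1}, y consecutively              *)

Record code (LA LB : language) := Code {
  dim : nat; pdim : nat;
  cU : formula LB; cE : formula LB; cQ : fsym LA -> formula LB }.

(* Semantic code: the sets U, E, Q_Gamma given as predicates on tuples of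
   some type T (used both for codes evaluated in a structure and for the
   composition of two codes). *)
Record scode (LA : language) (T : Type) := SCode {
  sU : T -> Prop;
  sE : T -> T -> Prop;
  sQ : forall f : fsym LA, ('I_(arity f).+1 -> T) -> Prop }.
Arguments sU {LA T} s _.
Arguments sE {LA T} s _ _.
Arguments sQ {LA T} s f _.

(* mu : U -> A is a coordinate map: a surjection U -> A inducing an
   isomorphism U/E -> A, where Q_Gamma is the preimage of the graph of Q^A. *)
Definition is_coord_map (LA : language) (T : Type) (S : scode LA T)
    (A : structure LA) (mu : T -> A) : Prop :=
  (forall a : A, exists t, sU S t /\ mu t = a) /\
  (forall t t', sU S t -> sU S t' -> (sE S t t' <-> mu t = mu t')) /\
  (forall (f : fsym LA) (ts : 'I_(arity f).+1 -> T),
      (forall i, sU S (ts i)) ->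
      (sQ S f ts <->
         interp A f (fun j => mu (ts (widen_ord (leqnSn _) j))) = mu (ts ord_max))).

Definition csem (LA LB : language) (G : code LA LB) (B : structure LB)
    (p : 'I_(pdim G) -> B) : scode LA ('I_(dim G) -> B) :=
  @SCode LA ('I_(dim G) -> B)
    (fun t => holds B (cU G) (tseq t ++ tseq p))
    (fun t t' => holds B (cE G) (tseq t ++ tseq t' ++ tseq p))
    (fun f ts => holds B (cQ G f) (flatten (map tseq (tseq ts)) ++ tseq p)).

Arguments csem {LA LB} G B p.
Arguments is_coord_map {LA T} S A mu.

Definition interprets (LA LB : language) (G : code LA LB) (A : structure LA)
    (B : structure LB) (p : 'I_(pdim G) -> B) : Prop :=
  exists mu : ('I_(dim G) -> B) -> A, is_coord_map (csem G B p) A mu.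

Arguments interprets {LA LB} G A B p.

Definition regular_interp (LA LB : language) (G : code LA LB) (phi : formula LB)
    (A : structure LA) (B : structure LB) : Prop :=
  (exists p : 'I_(pdim G) -> B, holds B phi (tseq p)) /\
  (forall p : 'I_(pdim G) -> B, holds B phi (tseq p) -> interprets G A B p).

Arguments regular_interp {LA LB} G phi A B.

(* Translation chi |-> chi_Delta, given by its semantics: variables    *)
(* range over tuples in U_Delta, equality is E_Delta, symbols are      *)
(* read through the graphs Q_Delta.                                    *)

Section Translation.
Variables (LB : language) (T : Type) (S : scode LB T).

Fixpoint evR (w : nat -> T) (t : term LB) (u : T) : Prop :=
  match t with
  | Var i => sE S (w i) u
  | App f ts => exists vs : 'I_(arity f) -> T,
      (forall j, sU S (vs j) /\ evR w (ts j) (vs j)) /\ sQ S f (ext vs u)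
  end.

Fixpoint satT (w : nat -> T) (phi : formula LB) : Prop :=
  match phi with
  | FEq t1 t2 => exists u1 u2, sU S u1 /\ sU S u2 /\
                   evR w t1 u1 /\ evR w t2 u2 /\ sE S u1 u2
  | FNot p => ~ satT w p
  | FAnd p q => satT w p /\ satT w q
  | FOr p q => satT w p \/ satT w q
  | FImp p q => satT w p -> satT w q
  | FEx x p => exists u, sU S u /\ satT (upd w x u) p
  | FAll x p => forall u, sU S u -> satT (upd w x u) p
  end.

Definition holdsT (chi : formula LB) (us : seq T) : Prop :=
  (forall u, List.In u us -> sU S u) /\
  forall w : nat -> T, (forall i, sU S (w i)) ->
    (forall i, i < size us -> w i = nth (w i) us i) -> satT w chi.

End Translation.
Arguments evR {LB T} S w t u.
Arguments satT {LB T} S w phi.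
Arguments holdsT {LB T} S chi us.

Definition comp_sem (LA LB LC : language) (G : code LA LB) (D : code LB LC)
    (C : structure LC) (pp : 'I_(pdim G) -> 'I_(dim D) -> C)
    (q : 'I_(pdim D) -> C) : scode LA ('I_(dim G) -> 'I_(dim D) -> C) :=
  let S := csem D C q in
  @SCode LA ('I_(dim G) -> 'I_(dim D) -> C)
    (fun u => holdsT S (cU G) (tseq u ++ tseq pp))
    (fun u u' => holdsT S (cE G) (tseq u ++ tseq u' ++ tseq pp))
    (fun f us => holdsT S (cQ G f) (flatten (map tseq (tseq us)) ++ tseq pp)).

Arguments comp_sem {LA LB LC} G D C pp q.

Definition comp_param (LA LB LC : language) (G : code LA LB) (D : code LB LC)
    (phi : formula LB) (psi : formula LC) (C : structure LC)
    (pp : 'I_(pdim G) -> 'I_(dim D) -> C) (q : 'I_(pdim D) -> C) : Prop :=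
  holdsT (csem D C q) phi (tseq pp) /\ holds C psi (tseq q).

Arguments comp_param {LA LB LC} G D phi psi C pp q.

Definition flat {T : Type} {n m : nat} (u : 'I_n -> 'I_m -> T) : seq T :=
  flatten (map tseq (tseq u)).

Definition defines_graph (LA LB : language) (G : code LA LB) (D : code LB LA)
    (A : structure LA) (theta : formula LA)
    (pp : 'I_(pdim G) -> 'I_(dim D) -> A) (q : 'I_(pdim D) -> A)
    (mu : ('I_(dim G) -> 'I_(dim D) -> A) -> A) : Prop :=
  forall (u : 'I_(dim G) -> 'I_(dim D) -> A) (x : A),
    holds A theta (flat u ++ [:: x] ++ flat pp ++ tseq q) <->
    (sU (comp_sem G D A pp q) u /\ x = mu u).

Arguments defines_graph {LA LB} G D A theta pp q mu.

Definition strongly_regularly_biinterpretable (LA LB : language)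
    (A : structure LA) (B : structure LB) : Prop :=
  exists (G : code LA LB) (phi : formula LB) (D : code LB LA) (psi : formula LA)
         (thetaA : formula LA) (thetaB : formula LB),
    regular_interp G phi A B /\ regular_interp D psi B A /\
    (forall pp q, comp_param G D phi psi A pp q ->
       exists mu, is_coord_map (comp_sem G D A pp q) A mu /\
                  defines_graph G D A thetaA pp q mu) /\
    (forall qq p, comp_param D G psi phi B qq p ->
       exists mu, is_coord_map (comp_sem D G B qq p) B mu /\
                  defines_graph D G B thetaB qq p mu) /\
    (forall (p : 'I_(pdim G) -> B) (q : 'I_(pdim D) -> A),
       holds B phi (tseq p) -> holds A psi (tseq q) ->
       exists (muG : ('I_(dim G) -> B) -> A) (muD : ('I_(dim D) -> A) -> B),
         is_coord_map (csem G B p) A muG /\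
         is_coord_map (csem D A q) B muD /\
         (forall pp : 'I_(pdim G) -> 'I_(dim D) -> A,
            (forall i, sU (csem D A q) (pp i) /\ muD (pp i) = p i) ->
            defines_graph G D A thetaA pp q (fun u => muG (fun i => muD (u i)))) /\
         (forall qq : 'I_(pdim D) -> 'I_(dim G) -> B,
            (forall i, sU (csem G B p) (qq i) /\ muG (qq i) = q i) ->
            defines_graph D G B thetaB qq p (fun u => muD (fun i => muG (u i))))).

Inductive gsym := gmul | ginv | gone.
Definition garity (f : gsym) : nat :=
  match f with gmul => 2 | ginv => 1 | gone => 0 end.
Definition Lgroup : language := Language garity.

Inductive rsym := radd | rmul | rzero | rone.
Definition rarity (f : rsym) : nat :=
  match f with radd => 2 | rmul => 2 | rzero => 0 | rone => 0 end.
Definition Lring : language := Language rarity.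

Section GroupOps.
Variable G : structure Lgroup.
Definition gm (x y : G) : G :=
  interp G (gmul : fsym Lgroup) (fun i : 'I_2 => if i == ord0 then x else y).
Definition gi (x : G) : G := interp G (ginv : fsym Lgroup) (fun _ : 'I_1 => x).
Definition ge : G := interp G (gone : fsym Lgroup) (fun i : 'I_0 => match i with Ordinal _ h => False_rect _ (notF h) end).
Definition gpow (x : G) (n : nat) : G := iter n (gm x) ge.

Definition is_group : Prop :=
  (forall x y z, gm x (gm y z) = gm (gm x y) z) /\
  (forall x, gm ge x = x /\ gm x ge = x) /\
  (forall x, gm (gi x) x = ge /\ gm x (gi x) = ge).
End GroupOps.

Definition group_hom (G H : structure Lgroup) (h : G -> H) : Prop :=
  forall x y, h (gm x y) = gm (h x) (h y).

(* G, with distinguished a, b, is the group presented by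
   < a, b | b^-1 a b = a^k > : a group satisfying the relation, generated by
   a and b, with the universal property of the presentation. *)
Definition BS_presentation (k : nat) (G : structure Lgroup) (a b : G) : Prop :=
  is_group G /\
  gm (gm (gi b) a) b = gpow a k /\
  (forall P : G -> Prop, P a -> P b -> P (ge G) ->
     (forall x y, P x -> P y -> P (gm x y)) -> (forall x, P x -> P (gi x)) ->
     forall x, P x) /\
  (forall (H : structure Lgroup) (c d : H), is_group H ->
     gm (gm (gi d) c) d = gpow c k ->
     exists h : G -> H, group_hom h /\ h a = c /\ h b = d).

Definition Zinterp (f : fsym Lring) : ('I_(arity f) -> Z) -> Z :=
  match f as f0 return ('I_(rarity f0) -> Z) -> Z with
  | radd => fun s => (s ord0 + s ord_max)%Z
  | rmul => fun s => (s ord0 * s ord_max)%Z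
  | rzero => fun _ => 0%Z
  | rone => fun _ => 1%Z
  end.
Definition Zring : structure Lring := Structure Zinterp.
Arguments BS_presentation k G a b : clear implicits.
Arguments strongly_regularly_biinterpretable {LA LB} A B.

(* Main.v *)
(** BS(1,k) is Z[1/k] x| Z: the map a |-> (t |-> t + 1), b |-> (t |-> t / k) into
    the affine group of the line is injective by the normal form b^i a^m b^l, and
    it gives coordinates X : G -> Z[1/k] and N : G -> Z.

    In Z, the element b^-j a^m b^j b^n with coordinates X = m k^j, N = n is coded by
    (m, j, n).  This needs the graph of n |-> k^n to be definable in the ring Z,
    which is done with Goedel's beta function; the order of Z is definable since
    n >= 0 iff n w^2 is a sum of four squares for some w <> 0.

    In G, the integer n is coded by b^n in the centralizer of b.  Since
    k^c - 1 divides k^d - 1 in Z[1/k] iff c | d, divisibility is definable, and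
    addition and divisibility define multiplication (J. Robinson).  The relation
    "h = a^m" between h and b^m is definable because
    k^(m j) - 1 = m (k^j - 1) modulo (k^j - 1)^2 for every j.  Hence G itself can
    define the decoding (b^m, b^j, b^n) |-> b^-j a^m b^j b^n.  The pairs (a, b) for
    which this decoding is onto, with a <> 1 and b^-1 a b = a^k, are the parameters
    allowed; each of them yields coordinate maps with the same formulas.  The other
    composite sends a code (m, j, n) of an element of the centralizer of b to n. *)

From Stdlib Require Import ZArith Lia Reals Lra.
From Stdlib Require Import FunctionalExtensionality IndefiniteDescription.
Require Import Defs.
From mathcomp Require Import all_boot.
From mathcomp Require Import zify.

Set Implicit Arguments.
Unset Strict Implicit.
Unset Printing Implicit Defensive.

(* The key R is taken by mathcomp's ring_scope. *)
Delimit Scope R_scope with Re.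

(** * Definability and translation *)

Section Substitution.
Variable L : language.

Fixpoint tbound (t : term L) : nat :=
  match t with
  | Var i => i.+1
  | App f ts => \max_j tbound (ts j)
  end.

Fixpoint fbound (p : formula L) : nat :=
  match p with
  | FEq s t => maxn (tbound s) (tbound t)
  | FNot p => fbound p
  | FAnd p q | FOr p q | FImp p q => maxn (fbound p) (fbound q)
  | FEx _ p | FAll _ p => fbound p
  end.

Fixpoint tsub (s : nat -> term L) (t : term L) : term L :=
  match t with
  | Var i => s i
  | App f ts => App (fun j => tsub s (ts j))
  end.

(** Renaming a bound variable to this index avoids capture: it exceeds every variable of the terms
    substituted for the indices below [n]. *)
Definition fresh (s : nat -> term L) (n : nat) := \max_(i < n) tbound (s i).

Fixpoint fsub (s : nat -> term L) (p : formula L) : formula L :=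
  match p with
  | FEq t u => FEq (tsub s t) (tsub s u)
  | FNot p => FNot (fsub s p)
  | FAnd p q => FAnd (fsub s p) (fsub s q)
  | FOr p q => FOr (fsub s p) (fsub s q)
  | FImp p q => FImp (fsub s p) (fsub s q)
  | FEx x p => let z := fresh s (fbound p) in FEx z (fsub (upd s x (Var L z)) p)
  | FAll x p => let z := fresh s (fbound p) in FAll z (fsub (upd s x (Var L z)) p)
  end.

Variable M : structure L.

Lemma eval_bound (v w : nat -> M) t :
  (forall i, i < tbound t -> v i = w i) -> eval M v t = eval M w t.
Proof.
elim: t => [i|f ts IH] /= vw; first exact: vw.
congr interp; apply: functional_extensionality => j; apply: IH => i lti.
by apply: vw; apply: leq_trans lti _; apply: leq_bigmax.
Qed.

Lemma sat_bound p (v w : nat -> M) :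
  (forall i, i < fbound p -> v i = w i) -> sat M v p <-> sat M w p.
Proof.
have bin (q1 q2 : formula L) (v' w' : nat -> M) :
    (forall i, i < maxn (fbound q1) (fbound q2) -> v' i = w' i) ->
    (forall i, i < fbound q1 -> v' i = w' i) /\
    (forall i, i < fbound q2 -> v' i = w' i).
  by move=> vw; split=> i lti; apply: vw; rewrite leq_max lti ?orbT.
have qu (q : formula L) (v' w' : nat -> M) x a :
    (forall i, i < fbound q -> v' i = w' i) ->
    (forall i, i < fbound q -> upd v' x a i = upd w' x a i).
  by move=> vw i lti; rewrite /upd vw.
elim: p v w => [s t|p IH|p IHp q IHq|p IHp q IHq|p IHp q IHq|x p IH|x p IH] v w /= vw.
- rewrite (@eval_bound v w s) ?(@eval_bound v w t) // => i lti;
  by apply: vw; rewrite leq_max lti ?orbT.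
- by have := IH _ _ vw; tauto.
- by have [/IHp ? /IHq ?] := bin _ _ _ _ vw; tauto.
- by have [/IHp ? /IHq ?] := bin _ _ _ _ vw; tauto.
- by have [/IHp ? /IHq ?] := bin _ _ _ _ vw; tauto.
- by split=> -[a Ha]; exists a;
    [apply/(IH _ _ (qu _ _ _ x a vw)).1 | apply/(IH _ _ (qu _ _ _ x a vw)).2].
- by split=> H a; [apply/(IH _ _ (qu _ _ _ x a vw)).1 | apply/(IH _ _ (qu _ _ _ x a vw)).2].
Qed.

Lemma eval_tsub (v : nat -> M) s t :
  eval M v (tsub s t) = eval M (fun i => eval M v (s i)) t.
Proof.
elim: t => [i|f ts IH] //=; congr interp.
by apply: functional_extensionality => j; apply: IH.
Qed.

Lemma sat_fsub p (v : nat -> M) s :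
  sat M v (fsub s p) <-> sat M (fun i => eval M v (s i)) p.
Proof.
have qu (q : formula L) (v' : nat -> M) s' x a : let z := fresh s' (fbound q) in
    sat M (fun i => eval M (upd v' z a) (upd s' x (Var L z) i)) q <->
    sat M (upd (fun i => eval M v' (s' i)) x a) q.
  move=> z; apply: sat_bound => i lti; rewrite /upd; case: eqP => //= _.
    by rewrite eqxx.
  (* A variable [l] of [s' i] differs from the fresh [z], so the update at [z] is invisible to
     it. *)
  apply: eval_bound => l ltl; case: eqP => // lz; move: ltl; rewrite lz ltnNge.
  by move/negP; case; apply: (@leq_bigmax _ (fun i : 'I__ => tbound (s' i)) (Ordinal lti)).
elim: p v s => [t u|p IH|p IHp q IHq|p IHp q IHq|p IHp q IHq|x p IH|x p IH] v s /=.
- by rewrite !eval_tsub.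
- by have := IH v s; tauto.
- by have := IHp v s; have := IHq v s; tauto.
- by have := IHp v s; have := IHq v s; tauto.
- by have := IHp v s; have := IHq v s; tauto.
- by split=> -[a H]; exists a; [apply/qu/IH | apply/IH/qu].
- by split=> H a; [apply/qu/IH | apply/IH/qu].
Qed.

End Substitution.

(** * Closure properties of definable predicates *)

Section Definability.
Variables (L : language) (M : structure L).
Implicit Types (P Q : (nat -> M) -> Prop) (f g h : (nat -> M) -> M).

(** Stated for predicates on whole valuations, so that closure lemmas prove definability with no
    formula written out. *)
Definition definable P := exists p, forall v, sat M v p <-> P v.
Definition tdef f := exists t, forall v, eval M v t = f v.

Lemma def_ext P Q : (forall v, P v <-> Q v) -> definable P -> definable Q.
Proof. by move=> PQ [p pP]; exists p => v; rewrite pP. Qed.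

Lemma def_not P : definable P -> definable (fun v => ~ P v).
Proof. by case=> p pP; exists (FNot p) => v /=; rewrite pP. Qed.

Lemma def_and P Q : definable P -> definable Q -> definable (fun v => P v /\ Q v).
Proof. by case=> p pP [q qP]; exists (FAnd p q) => v /=; rewrite pP qP. Qed.

Lemma def_or P Q : definable P -> definable Q -> definable (fun v => P v \/ Q v).
Proof. by case=> p pP [q qP]; exists (FOr p q) => v /=; rewrite pP qP. Qed.

Lemma def_imp P Q : definable P -> definable Q -> definable (fun v => P v -> Q v).
Proof. by case=> p pP [q qP]; exists (FImp p q) => v /=; rewrite pP qP. Qed.

Lemma def_eq f g : tdef f -> tdef g -> definable (fun v => f v = g v).
Proof. by case=> t tP [u uP]; exists (FEq t u) => v /=; rewrite tP uP. Qed.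

Lemma def_true : definable (fun=> True).
Proof. by exists (FEq (Var L 0) (Var L 0)). Qed.

Lemma tdef_var i : tdef (fun v => v i).
Proof. by exists (Var L i). Qed.

Definition scons (a : M) (v : nat -> M) i := if i is j.+1 then v j else a.

(* The bound variable becomes variable 0 of the body, de Bruijn style. *)
Let body p := fsub (fun i => if i is j.+1 then Var L j else Var L (fbound p)) p.

Let sat_body p v a : sat M (upd v (fbound p) a) (body p) <-> sat M (scons a v) p.
Proof.
rewrite sat_fsub; apply: sat_bound => -[|i] lti /=; rewrite /upd ?eqxx //.
by case: eqP => // e; move: lti; rewrite e ltnNge leqnSn.
Qed.

(** Reading the body on the shifted valuation lets unification alone decompose goals with nested
    quantifiers. *)
Lemma def_ex (Q : M -> (nat -> M) -> Prop) :
  definable (fun v => Q (v 0) (fun i => v i.+1)) ->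
  definable (fun v => exists a, Q a v).
Proof.
case=> p pP; exists (FEx (fbound p) (body p)) => v /=.
by split=> -[a H]; exists a; [have /pP := (sat_body p v a).1 H | apply/sat_body/pP].
Qed.

Lemma def_all (Q : M -> (nat -> M) -> Prop) :
  definable (fun v => Q (v 0) (fun i => v i.+1)) ->
  definable (fun v => forall a, Q a v).
Proof.
case=> p pP; exists (FAll (fbound p) (body p)) => v /=; split=> H a.
  exact: (pP (scons a v)).1 ((sat_body p v a).1 (H a)).
exact: (sat_body p v a).2 ((pP (scons a v)).2 (H a)).
Qed.

Lemma def_sub P ts :
  definable P -> definable (fun v => P (fun i => eval M v (nth (Var L 0) ts i))).
Proof. by case=> p pP; exists (fsub (nth (Var L 0) ts) p) => v; rewrite sat_fsub pP. Qed.

(** Substitution moves a relation proved definable at the first variables to arbitrary terms; the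
    versions up to [def6] serve the same end. *)
Lemma def2 (R : M -> M -> Prop) f g :
  definable (fun v => R (v 0) (v 1)) -> tdef f -> tdef g ->
  definable (fun v => R (f v) (g v)).
Proof.
by move=> D [t tP] [u uP]; apply: def_ext (def_sub [:: t; u] D) => v /=; rewrite tP uP.
Qed.

Lemma def3 (R : M -> M -> M -> Prop) f g h :
  definable (fun v => R (v 0) (v 1) (v 2)) -> tdef f -> tdef g -> tdef h ->
  definable (fun v => R (f v) (g v) (h v)).
Proof.
move=> D [t tP] [u uP] [w wP].
by apply: def_ext (def_sub [:: t; u; w] D) => v /=; rewrite tP uP wP.
Qed.

Lemma def4 (R : M -> M -> M -> M -> Prop) f g h h1 :
  definable (fun v => R (v 0) (v 1) (v 2) (v 3)) ->
  tdef f -> tdef g -> tdef h -> tdef h1 ->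
  definable (fun v => R (f v) (g v) (h v) (h1 v)).
Proof.
move=> D [t tP] [u uP] [w wP] [x xP].
by apply: def_ext (def_sub [:: t; u; w; x] D) => v /=; rewrite tP uP wP xP.
Qed.

Lemma def5 (R : M -> M -> M -> M -> M -> Prop) f g h h1 h2 :
  definable (fun v => R (v 0) (v 1) (v 2) (v 3) (v 4)) ->
  tdef f -> tdef g -> tdef h -> tdef h1 -> tdef h2 ->
  definable (fun v => R (f v) (g v) (h v) (h1 v) (h2 v)).
Proof.
move=> D [t tP] [u uP] [w wP] [x xP] [y yP].
by apply: def_ext (def_sub [:: t; u; w; x; y] D) => v /=; rewrite tP uP wP xP yP.
Qed.

Lemma def6 (R : M -> M -> M -> M -> M -> M -> Prop) f g h h1 h2 h3 :
  definable (fun v => R (v 0) (v 1) (v 2) (v 3) (v 4) (v 5)) ->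
  tdef f -> tdef g -> tdef h -> tdef h1 -> tdef h2 -> tdef h3 ->
  definable (fun v => R (f v) (g v) (h v) (h1 v) (h2 v) (h3 v)).
Proof.
move=> D [t tP] [u uP] [w wP] [x xP] [y yP] [z zP].
by apply: def_ext (def_sub [:: t; u; w; x; y; z] D) => v /=; rewrite tP uP wP xP yP zP.
Qed.

(** A valuation agrees with [s] on its length iff it has the form [nth (v i) s i]. The last
    hypothesis makes the truth value independent of the entries beyond [s]; inhabitation provides a
    valuation to test. *)
Lemma holds_iff p P s (R : Prop) :
  inhabited M -> (forall v, sat M v p <-> P v) ->
  (forall v, P (fun i => nth (v i) s i) <-> R) -> holds M p s <-> R.
Proof.
move=> [d] pP PR; split=> [H|r v vs].
  by apply/(PR (fun=> d))/pP/H => i lti; apply: set_nth_default.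
have -> : v = fun i => nth (v i) s i.
  apply: functional_extensionality => i.
  by case: (ltnP i (size s)) => [/vs //|?]; rewrite nth_default.
by apply/pP/PR.
Qed.

End Definability.

(** * Formulas read through a coordinate map *)

Section Translation.
Variables (LB : language) (T : Type) (S : scode LB T) (B : structure LB) (mu : T -> B).
Hypothesis cm : is_coord_map S B mu.

Lemma ext_widen (n : nat) (vs : 'I_n -> T) u (j : 'I_n) :
  ext vs u (widen_ord (leqnSn n) j) = vs j.
Proof.
rewrite /ext; have -> : widen_ord (leqnSn n) j = lift ord_max j.
  by apply: val_inj; rewrite /= /bump leqNgt ltn_ord.
by rewrite liftK.
Qed.

Lemma ext_max (n : nat) (vs : 'I_n -> T) u : ext vs u ord_max = u.
Proof. by rewrite /ext unlift_none. Qed.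

Lemma evR_eval w t u : (forall i, sU S (w i)) -> sU S u ->
  evR S w t u <-> eval B (mu \o w) t = mu u.
Proof.
have [sj [eqm gr]] := cm; move=> Uw; elim: t u => [i|f ts IH] u Uu /=.
  exact: eqm.
have Uext (vs : 'I_(arity f) -> T) : (forall j, sU S (vs j)) -> forall i, sU S (ext vs u i).
  by move=> Uvs i; rewrite /ext; case: unliftP.
split=> [[vs [H /gr]]|H].
  move=> /(_ (Uext _ (fun j => (H j).1))); rewrite ext_max => <-.
  congr interp; apply: functional_extensionality => j; rewrite ext_widen.
  by have [Uj /IH] := H j; apply.
(* Surjectivity of [mu] supplies representatives of the argument values. *)
have [vs vsP] := fin_all_exists (fun j => sj (eval B (mu \o w) (ts j))).
exists vs; split=> [j|].
  by have [Uj e] := vsP j; split=> //; apply/IH.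
apply/gr; first by apply: Uext => j; have [] := vsP j.
rewrite ext_max -H; congr interp; apply: functional_extensionality => j.
by rewrite ext_widen; have [] := vsP j.
Qed.

(** As [mu] maps the domain onto [B], quantifiers on both sides range over the same values; atomic
    formulas are matched by [evR_eval]. *)
Lemma satT_sat w p : (forall i, sU S (w i)) -> satT S w p <-> sat B (mu \o w) p.
Proof.
have [sj [eqm gr]] := cm.
have updU w' x u : (forall i, sU S (w' i)) -> sU S u -> forall i, sU S (upd w' x u i).
  by move=> Uw Uu i; rewrite /upd; case: ifP.
have updE w' x u : mu \o upd w' x u = upd (mu \o w') x (mu u).
  by apply: functional_extensionality => i; rewrite /= /upd; case: ifP.
elim: p w => [t u|p IH|p IHp q IHq|p IHp q IHq|p IHp q IHq|x p IH|x p IH] w Uw /=.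
- split=> [[u1 [u2 [U1 [U2 [/evR_eval e1 [/evR_eval e2 /eqm e]]]]]]|e].
    by rewrite e1 // e2 // e.
  have [u1 [U1 e1]] := sj (eval B (mu \o w) t).
  exists u1, u1; split=> //; split=> //; split; first exact/evR_eval.
  by split; [apply/evR_eval; rewrite // -e | apply/eqm].
- by rewrite IH.
- by rewrite IHp // IHq.
- by rewrite IHp // IHq.
- by rewrite IHp // IHq.
- split=> [[u [Uu]]|[a]].
    by rewrite IH ?updE; [exists (mu u) | apply: updU].
  have [u [Uu <-]] := sj a; rewrite -updE => H; exists u; split=> //.
  by apply/IH => //; apply: updU.
- split=> [H a|H u Uu].
    have [u [Uu <-]] := sj a; rewrite -updE; apply/IH; last exact: H.
    exact: updU.
  by apply/IH; [apply: updU | rewrite updE].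
Qed.

Lemma holdsT_holds p us :
  holdsT S p us <-> (forall u, List.In u us -> sU S u) /\ holds B p (map mu us).
Proof.
have [sj _] := cm.
have nthU i d : (forall u, List.In u us -> sU S u) -> i < size us -> sU S (nth d us i).
  elim: us i => [|u s IH] [|i] //= Us lti; first by apply: Us; left.
  by apply: IH => // u' u's; apply: Us; right.
split=> -[Us H]; split=> //.
  move=> v vP.
  (* The valuation in [B] is lifted through [mu], keeping the prescribed tuples [us] at the initial
     indices. *)
  have [i|w wP] := functional_choice
      (fun i t => [/\ sU S t, mu t = v i & i < size us -> t = nth t us i]).
    have [t [Ut e]] := sj (v i).
    case: (ltnP i (size us)) => [lti|]; last by exists t.
    exists (nth t us i); split=> [||_]; [exact: nthU| |exact: set_nth_default].
    by rewrite vP ?size_map // (nth_map t).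
  have -> : v = mu \o w by apply: functional_extensionality => i; have [] := wP i.
  by apply/satT_sat; [move=> i; have [] := wP i | apply: H => i; have [] := wP i].
move=> w Uw wP; apply/satT_sat => //; apply: H => i; rewrite size_map => lti /=.
by rewrite (nth_map (w i)) // -wP.
Qed.

End Translation.

Section Tuples.
Variables (T T' : Type).

Lemma tseq_map n (f : T -> T') (t : 'I_n -> T) : map f (tseq t) = tseq (fun i => f (t i)).
Proof. by rewrite /tseq -map_comp. Qed.

Lemma In_tseq n (t : 'I_n -> T) x : List.In x (tseq t) <-> exists i, x = t i.
Proof.
rewrite /tseq; split.
  by elim: (enum 'I_n) => //= i s IH [<-|/IH //]; exists i.
case=> i ->; have := mem_enum 'I_n i; elim: (enum 'I_n) => //= j s IH.
by rewrite inE => /orP[/eqP->|/IH]; [left | right].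
Qed.

Lemma tseq0 (t : 'I_0 -> T) : tseq t = [::].
Proof. by apply: size0nil; rewrite size_map size_enum_ord. Qed.

Lemma tseqS n (t : 'I_n.+1 -> T) : tseq t = t ord0 :: tseq (fun i => t (lift ord0 i)).
Proof. by rewrite /tseq enum_ordSl /= -map_comp. Qed.

End Tuples.

(** * Coordinate maps of composed codes *)

Section Composition.
Variables (LA LB LC : language) (G : code LA LB) (D : code LB LC).
Variables (A : structure LA) (B : structure LB) (C : structure LC).
Variables (p : 'I_(pdim G) -> B) (q : 'I_(pdim D) -> C).
Variables (muG : ('I_(dim G) -> B) -> A) (muD : ('I_(dim D) -> C) -> B).
Hypothesis cmG : is_coord_map (csem G B p) A muG.
Hypothesis cmD : is_coord_map (csem D C q) B muD.
Variable pp : 'I_(pdim G) -> 'I_(dim D) -> C.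
Hypothesis ppP : forall i, sU (csem D C q) (pp i) /\ muD (pp i) = p i.

Let In_cat (T : Type) (s1 s2 : seq T) x : List.In x (s1 ++ s2) -> List.In x s1 \/ List.In x s2.
Proof. exact: List.in_app_or. Qed.

Let Up u : List.In u (tseq pp) -> sU (csem D C q) u.
Proof. by case/In_tseq=> i ->; have [] := ppP i. Qed.

Let map_pp : map muD (tseq pp) = tseq p.
Proof.
by rewrite tseq_map; congr tseq; apply: functional_extensionality => i; have [] := ppP i.
Qed.

Lemma comp_sU u :
  sU (comp_sem G D C pp q) u <->
  (forall i, sU (csem D C q) (u i)) /\ sU (csem G B p) (fun i => muD (u i)).
Proof.
rewrite /comp_sem /= (holdsT_holds cmD) map_cat map_pp tseq_map.
split=> -[H1 H2]; split=> //.
  by move=> i; apply: H1; apply/List.in_or_app; left; apply/In_tseq; exists i.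
by move=> v Hv; case: (In_cat Hv) => [/In_tseq[i ->]|]; [exact: H1 | exact: Up].
Qed.

(** By [holdsT_holds], a formula of [G] translated along [D] holds at tuples of the domain iff the
    formula itself holds in [B] at their [muD]-images, so each clause falls back on that of
    [muG]. *)
Lemma comp_coord_map :
  is_coord_map (comp_sem G D C pp q) A (fun u => muG (fun i => muD (u i))).
Proof.
have [sG [eG qG]] := cmG; have [sD [eD qD]] := cmD; split; last split.
- move=> a; have [t [Ut <-]] := sG a.
  have [u uP] := fin_all_exists (fun i => sD (t i)).
  have e : (fun i => muD (u i)) = t.
    by apply: functional_extensionality => i; have [] := uP i.
  exists u; rewrite e; split=> //; apply/comp_sU; rewrite e; split=> // i.
  by have [] := uP i.
- move=> t t' /comp_sU[U1 U2] /comp_sU[U1' U2']; rewrite -(eG _ _ U2 U2').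
  rewrite /comp_sem /= (holdsT_holds cmD) !map_cat map_pp !tseq_map.
  split=> [[]|H] //; split=> //.
  move=> v Hv; case: (In_cat Hv) => [/In_tseq[i ->]|{}Hv]; first exact: U1.
  by case: (In_cat Hv) => [/In_tseq[i ->]|]; [exact: U1' | exact: Up].
- move=> f ts Uts.
  have Uts' i : (forall j, sU (csem D C q) (ts i j)) /\ sU (csem G B p) (fun j => muD (ts i j)).
    by apply/comp_sU.
  rewrite -(qG f (fun i j => muD (ts i j))); last by move=> i; have [] := Uts' i.
  rewrite /comp_sem /= (holdsT_holds cmD) map_cat map_pp map_flatten.
  have -> : [seq [seq muD j | j <- i] | i <- [seq tseq i | i <- tseq ts]]
          = [seq tseq i | i <- tseq (fun i j => muD (ts i j))].
    rewrite -map_comp -(tseq_map (fun t j => muD (t j))) -map_comp.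
    by apply: eq_map => t; rewrite /= tseq_map.
  split=> [[]|H] //; split=> //.
  move=> v Hv; case: (In_cat Hv); last exact: Up.
  have : forall t, List.In t (tseq ts) -> forall j, sU (csem D C q) (t j).
    by move=> t /In_tseq[i ->] j; have [] := Uts' i.
  elim: (tseq ts) {Hv} => [|t s IH] //= Ut Hv; case: (In_cat Hv) => [/In_tseq[j ->]|].
    by apply: (Ut t); left.
  by apply: IH => t' ?; apply: Ut; right.
Qed.

End Composition.

(** * Sums of four squares and the beta function *)

Lemma eq_sqr_mod_prime p x y : prime p -> x + y < p -> x * x = y * y %[mod p] -> x = y.
Proof.
move=> p_pr; wlog le_yx : x y / y <= x => [H|] xyp /eqP.
  case: (leqP y x) => [le|/ltnW le] /eqP e; first exact: H.
  by apply/esym/H => //; rewrite addnC.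
rewrite eqn_mod_dvd ?leq_mul //.
have -> : x * x - y * y = (x - y) * (x + y) by nia.
by rewrite Euclid_dvdM // => /orP[] /dvdn_leq H; lia.
Qed.

(** The factor [p.-1] plays the role of -1 modulo [p]. *)
Lemma modn_pred_mul p A B : 0 < p -> p.-1 * A = p.-1 * B %[mod p] -> A = B %[mod p].
Proof.
move=> p_gt0 e; apply/eqP; rewrite -(eqn_modDr (p.-1 * B)) -mulSn.
by rewrite -modnDmr -e modnDmr -mulSn prednK // !modnMr.
Qed.

(** Pigeonhole: with p = 2h + 1, the residues of x^2 and of -(y^2 + 1) for 0 <= x, y <= h are p + 1
    in number, and none repeats within one family. The bound m < p comes from x, y <= h. *)
Lemma prime_dvd_sum_two_squares p : prime p -> odd p ->
  exists x y m, x * x + y * y + 1 = p * m /\ 0 < m < p.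
Proof.
move=> p_pr p_odd; have p_gt0 := prime_gt0 p_pr.
set h := p./2; have ph : p = h.*2.+1 by rewrite -{1}(odd_double_half p) p_odd.
pose r n := Ordinal (ltn_pmod n p_gt0).
pose f (s : 'I_h.+1 + 'I_h.+1) :=
  match s with inl x => r (x * x) | inr y => r (p.-1 * (y * y + 1)) end.
case: (boolP (injectiveb f)) => [/injectiveP/leq_card|].
  by rewrite card_sum !card_ord {1}ph; lia.
have mixed (x y : 'I_h.+1) : x * x = p.-1 * (y * y + 1) %[mod p] ->
    exists x y m, x * x + y * y + 1 = p * m /\ 0 < m < p.
  move/eqP; rewrite -(eqn_modDr (y * y + 1)) -mulSnr prednK // modnMr => /dvdnP[m e].
  exists x, y, m; split; first by rewrite mulnC -e addnA.
  have xh := ltn_ord x; have yh := ltn_ord y.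
  have xx : x * x <= h * h by apply: leq_mul.
  have yy : y * y <= h * h by apply: leq_mul.
  have p_gt1 := prime_gt1 p_pr.
  have pp : p * p = 4 * (h * h) + 4 * h + 1 by rewrite ph; lia.
  apply/andP; split; first by case: m e => //; lia.
  by rewrite -(ltn_pmul2r p_gt0) -e pp; lia.
case/injectivePn => -[x|x] [] [y|y] /eqP neq [] e; have xh := ltn_ord x; have yh := ltn_ord y;
  have xyp : x + y < p by move: xh yh; rewrite {}ph; clear; lia.
- by case: neq; congr inl; apply: val_inj; apply: (@eq_sqr_mod_prime p).
- exact: (mixed x y).
- exact/(mixed y x)/esym.
- have {}e := modn_pred_mul p_gt0 e.
  case: neq; congr inr; apply: val_inj; apply: (@eq_sqr_mod_prime p) => //.
  by apply/eqP; move/eqP: e; rewrite eqn_modDr.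
Qed.

(* Rational rather than integral squares: this set is closed under division,
   so Lagrange's descent is not needed. *)
Definition sum4sq (n : Z) : Prop := exists w a b c d : Z,
  w <> 0%Z /\ (n * (w * w) = a * a + b * b + c * c + d * d)%Z.

(** Euler's four-square identity; the denominators multiply. *)
Lemma sum4sqM m n : sum4sq m -> sum4sq n -> sum4sq (m * n).
Proof.
move=> [w [a [b [c [d [w0 e]]]]]] [w' [a' [b' [c' [d' [w0' e']]]]]].
exists (w * w')%Z, (a * a' + b * b' + c * c' + d * d')%Z,
  (a * b' - b * a' + c * d' - d * c')%Z, (a * c' - c * a' + d * b' - b * d')%Z,
  (a * d' - d * a' + b * c' - c * b')%Z.
split; first by nia.
transitivity ((m * (w * w)) * (n * (w' * w')))%Z; first by ring.
by rewrite e e'; ring.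
Qed.

(** Multiplying by [m] once more gives m^2 n, and the square is absorbed into the denominator. *)
Lemma sum4sq_div m n : m <> 0%Z -> sum4sq (m * n) -> sum4sq m -> sum4sq n.
Proof.
move=> m0 H1 H2; have [w [a [b [c [d [w0 e]]]]]] := sum4sqM H1 H2.
by exists (m * w)%Z, a, b, c, d; split; [nia | rewrite -e; ring].
Qed.

Lemma sum4sqP n : (0 <= n)%Z <-> sum4sq n.
Proof.
split=> [|[w [a [b [c [d [w0 e]]]]]]]; last first.
  have : (0 < w * w)%Z by nia.
  have : (0 <= n * (w * w))%Z by nia.
  by nia.
move/Z2Nat.id => <-; elim/ltn_ind: (Z.to_nat n) => {}n IH.
case: (ltnP 2 n) => [n_gt2|n_le2].
  have [n_pr|n_npr] := boolP (prime n).
    have n_odd : odd n by case/even_prime: n_pr => // n2; rewrite n2 in n_gt2.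
    (* The multiple [n * m] with [m < n] is x^2 + y^2 + 1, and the induction hypothesis for [m]
       allows dividing it out. *)
    have [x [y [m [e lem]]]] := prime_dvd_sum_two_squares n_pr n_odd.
    apply: (@sum4sq_div (Z.of_nat m)); [lia| |by apply: IH; lia].
    exists 1%Z, (Z.of_nat x), (Z.of_nat y), 1%Z, 0%Z; split=> //; nia.
  have p_pr : prime (pdiv n) by apply: pdiv_prime; lia.
  have p_gt1 := prime_gt1 p_pr.
  have e := divnK (pdiv_dvd n).
  have neq : pdiv n <> n by move=> pn; rewrite -pn p_pr in n_npr.
  rewrite -e Nat2Z.inj_mul; apply: sum4sqM; apply: IH; first by apply: ltn_Pdiv => //; lia.
  by rewrite ltn_neqAle (introN eqP neq) pdiv_leq //; lia.
case: n n_le2 {IH} => [|[|[|//]]] _; [exists 1%Z,0%Z,0%Z,0%Z,0%Z|exists 1%Z,1%Z,0%Z,0%Z,0%Z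
  |exists 1%Z,1%Z,1%Z,0%Z,0%Z]; by split.
Qed.

(** A common divisor is coprime to N! and divides (j - i) N!, hence divides j - i, hence N!; so it
    is 1. *)
Lemma coprime_beta N i j : i < j <= N -> coprime (i.+1 * N`!).+1 (j.+1 * N`!).+1.
Proof.
move=> /andP[ij jN]; set d := N`!; rewrite /coprime; set g := gcdn _ _.
have g1 : g %| (i.+1 * d).+1 by apply: dvdn_gcdl.
have g2 : g %| (j.+1 * d).+1 by apply: dvdn_gcdr.
have cop : coprime g d.
  have : coprime (i.+1 * d).+1 d by rewrite coprime_sym -addn1 /coprime gcdnMDl gcdn1.
  by apply: coprime_dvdl.
have : g %| (j - i) * d.
  have -> : (j - i) * d = (j.+1 * d).+1 - (i.+1 * d).+1 by rewrite subSS -mulnBl subSS.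
  exact: dvdn_sub.
rewrite Gauss_dvdl // => gd; rewrite -dvdn1 -(Gauss_dvdl _ cop) mul1n.
by apply: dvdn_trans gd _; apply: dvdn_fact; lia.
Qed.

(** Chinese remaindering for these pairwise coprime moduli; each exceeds [N], so the values [f i]
    are the remainders themselves. *)
Lemma beta_lemma (f : nat -> nat) n N : n <= N -> (forall i, i <= n -> f i <= N) ->
  exists c, forall i, i <= n -> c %% (i.+1 * N`!).+1 = f i.
Proof.
move=> nN fN; set m := fun i => (i.+1 * N`!).+1.
have [c cP] : exists c, forall i, i < n.+1 -> c = f i %[mod m i].
  elim: {-2}n (leqnn n) => [|l IH] ln; first by exists (f 0) => -[].
  have [c cP] := IH (ltnW ln).
  have cop : coprime (\prod_(i < l.+1) m i) (m l.+1).
    apply: (big_ind (fun x => coprime x (m l.+1))) => [|x y Hx Hy|i _].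
    - exact: coprime1n.
    - by rewrite coprimeMl Hx.
    - by apply: coprime_beta; have := ltn_ord i; lia.
  exists (chinese (\prod_(i < l.+1) m i) (m l.+1) c (f l.+1)) => i.
  rewrite ltnS leq_eqVlt => /orP[/eqP->|il]; first exact: chinese_modr.
  have dv : m i %| \prod_(i < l.+1) m i by rewrite (bigD1 (Ordinal il)) //= dvdn_mulr.
  by rewrite -(cP _ il) -(modn_dvdm _ dv) chinese_modl // modn_dvdm.
exists c => i lin; rewrite (cP i) // modn_small // /m ltnS.
apply: leq_trans (fN i lin) _; apply: leq_trans (fact_geq N) _.
by rewrite mulSn leq_addr.
Qed.

(** * Definability in the ring of integers *)

Section IntegerDefinability.
Implicit Types (f g : (nat -> Zring) -> Z) (P : (nat -> Zring) -> Prop).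

Definition zterm f := @tdef _ Zring f.
Definition zdef P := definable P.

Lemma zterm_var i : zterm (fun v => v i).
Proof. exact: tdef_var. Qed.

Lemma zterm_add f g : zterm f -> zterm g -> zterm (fun v => f v + g v)%Z.
Proof.
case=> t tP [u uP].
by exists (@App Lring radd (fun i : 'I_2 => if i == ord0 then t else u)) => v /=; rewrite tP uP.
Qed.

Lemma zterm_mul f g : zterm f -> zterm g -> zterm (fun v => f v * g v)%Z.
Proof.
case=> t tP [u uP].
by exists (@App Lring rmul (fun i : 'I_2 => if i == ord0 then t else u)) => v /=; rewrite tP uP.
Qed.

Lemma zterm0 : zterm (fun=> 0%Z).
Proof. by exists (@App Lring rzero (fun=> Var _ 0)). Qed.

Lemma zterm1 : zterm (fun=> 1%Z).
Proof. by exists (@App Lring rone (fun=> Var _ 0)). Qed.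

Lemma zterm_nat n : zterm (fun=> Z.of_nat n).
Proof.
elim: n => [|n [t tP]]; first exact: zterm0.
have [u uP] := zterm_add (ex_intro _ t tP) zterm1.
by exists u => v; rewrite uP; lia.
Qed.

Lemma zdef_eq f g : zterm f -> zterm g -> zdef (fun v => f v = g v).
Proof. exact: def_eq. Qed.

End IntegerDefinability.

Ltac zterms := repeat first
  [ exact: zterm_var | exact: zterm0 | exact: zterm1 | exact: zterm_nat
  | apply: zterm_add | apply: zterm_mul ].
(* Syntactic matching keeps defined predicates folded. *)
Ltac defs := rewrite ?/zdef; cbv beta; repeat (lazymatch goal with
  | |- definable (fun v => _ /\ _) => apply: def_and
  | |- definable (fun v => _ \/ _) => apply: def_or
  | |- definable (fun v => ~ _) => apply: def_not
  | |- definable (fun v => exists a, _) => apply: def_ex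
  | |- definable (fun v => @?P v -> @?Q v) => apply: def_imp
  | |- definable (fun v => forall a, _) => apply: def_all
  end; cbv beta).

Lemma zdef_sum4sq : zdef (fun v => sum4sq (v 0)).
Proof. rewrite /sum4sq; defs; apply: zdef_eq; zterms. Qed.

Lemma zdef_le f g : zterm f -> zterm g -> zdef (fun v => f v <= g v)%Z.
Proof.
have le2 : zdef (fun v => Z.le (v 0) (v 1)).
  apply: (@def_ext _ Zring (fun v => exists d : Z, sum4sq d /\ (v 0%N + d)%Z = v 1)).
    move=> v; split=> [[d [/sum4sqP d0 e]]|le]; first by lia.
    by exists (v 1%N - v 0%N)%Z; rewrite -sum4sqP; lia.
  defs; last by apply: zdef_eq; zterms.
  exact: zdef_sum4sq.
exact: (@def2 _ Zring Z.le _ _ le2).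
Qed.

Lemma zdef_lt f g : zterm f -> zterm g -> zdef (fun v => f v < g v)%Z.
Proof.
move=> Df Dg; apply: (@def_ext _ Zring (fun v => f v + 1 <= g v)%Z); first by lia.
by apply: zdef_le; zterms.
Qed.

Ltac zdefs := defs; repeat first
  [ apply: zdef_le | apply: zdef_lt | apply: zdef_eq ]; try (by zterms).

Definition is_rem (c m r : Z) := (0 <= r)%Z /\ (r < m)%Z /\ exists q, c = (q * m + r)%Z.

Lemma zdef_is_rem f g h : zterm f -> zterm g -> zterm h ->
  zdef (fun v => is_rem (f v) (g v) (h v)).
Proof. by apply: (@def3 _ Zring is_rem); rewrite /is_rem; zdefs. Qed.

Lemma is_rem_mod c m r : (0 < m)%Z -> is_rem c m r <-> r = (c mod m)%Z.
Proof.
move=> m0; split=> [[r0 [rm [q ->]]]|->].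
  by rewrite Z.add_comm Z.mod_add ?Z.mod_small //; lia.
have := Z.mod_pos_bound c m m0; split; first by lia.
by split; [lia | exists (c / m)%Z; rewrite {1}(Z.div_mod c m); lia].
Qed.

(** * The graph of exponentiation, and linear equations between multiples of powers of k *)

Section Exponentiation.
Variables (k : nat) (k_gt1 : 1 < k).

(** [Z.pow] vanishes at negative exponents, so their exclusion is written into the relation. *)
Definition is_pow (n y : Z) := (0 <= n)%Z /\ y = (Z.of_nat k ^ n)%Z.

(** The remainders of [c] modulo 1 + (i + 1) d, for i = 0, ..., n, are forced to be 1, k, ...,
    k^n. *)
Definition beta_pow (n y : Z) := exists c d : Z,
  [/\ (0 <= n)%Z /\ (0 <= d)%Z, is_rem c (1 + d) 1,
   forall i r s, (0 <= i)%Z -> (i < n)%Z -> is_rem c (1 + (i + 1) * d) r ->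
     is_rem c (1 + (i + 1 + 1) * d) s -> s = (Z.of_nat k * r)%Z
  & is_rem c (1 + (n + 1) * d) y].

Lemma beta_powP n y : beta_pow n y <-> is_pow n y.
Proof.
split=> [[c [d [[n0 d0] r1 rS rn]]]|[n0 ->]].
  split=> //; have m0 i : (0 <= i)%Z -> (0 < 1 + (i + 1) * d)%Z by nia.
  have step (i : nat) : (Z.of_nat i <= n)%Z ->
      is_rem c (1 + (Z.of_nat i + 1) * d) (Z.of_nat k ^ Z.of_nat i)%Z.
    elim: i => [|i IH] lei; first by rewrite Z.add_0_l Z.mul_1_l.
    have Hi := IH ltac:(lia).
    have := @is_rem_mod c _ (c mod (1 + (Z.of_nat i.+1 + 1) * d))%Z (m0 (Z.of_nat i.+1) ltac:(lia)).
    case=> _ /(_ erefl) Hs.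
    have e : (Z.of_nat i.+1 = Z.of_nat i + 1)%Z by lia.
    rewrite e in Hs *; have Hs' := rS (Z.of_nat i) _ _ ltac:(lia) ltac:(lia) Hi Hs.
    have -> : (Z.of_nat k ^ (Z.of_nat i + 1) = Z.of_nat k * Z.of_nat k ^ Z.of_nat i)%Z.
      by rewrite Z.add_1_r Z.pow_succ_r //; lia.
    by rewrite -Hs'.
  have := step (Z.to_nat n); rewrite Z2Nat.id // => /(_ (Z.le_refl _)).
  move/(is_rem_mod _ _ (m0 _ n0)) => ->.
  by move/(is_rem_mod _ _ (m0 _ n0)): rn.
pose l := Z.to_nat n; have nl : n = Z.of_nat l by rewrite Z2Nat.id.
(* The bound l + k^l dominates both the indices and the values, as [beta_lemma] requires. *)
have kl i : i <= l -> k ^ i <= l + k ^ l.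
  by move=> il; apply: leq_trans (leq_addl _ _); rewrite leq_exp2l.
have [c cP] := @beta_lemma (fun i => k ^ i) l _ (leq_addr _ _) kl.
set d := (_ `!) in cP.
have zpow i : Z.of_nat (k ^ i) = (Z.of_nat k ^ Z.of_nat i)%Z.
  elim: i => [|i IH]; first by [].
  by rewrite expnS Nat2Z.inj_mul IH Nat2Z.inj_succ Z.pow_succ_r //; lia.
have rem i : i <= l ->
    is_rem (Z.of_nat c) (1 + (Z.of_nat i + 1) * Z.of_nat d) (Z.of_nat k ^ Z.of_nat i)%Z.
  move=> il; have := cP i il; have := divn_eq c (i.+1 * d).+1.
  have := ltn_pmod c (ltn0Sn (i.+1 * d)); move: (c %% _) (c %/ _) => r q rm cq rk.
  rewrite -zpow -rk; split; first by lia.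
  by split; [nia | exists (Z.of_nat q); nia].
have m0 i : (0 <= i)%Z -> (0 < 1 + (i + 1) * Z.of_nat d)%Z by nia.
exists (Z.of_nat c), (Z.of_nat d); split.
- by split=> //; lia.
- by have := rem 0 isT; rewrite Z.add_0_l Z.mul_1_l.
- move=> i r s i0 il.
  have [i' ei] : exists i', i = Z.of_nat i' by exists (Z.to_nat i); rewrite Z2Nat.id.
  move/(is_rem_mod _ _ (m0 _ i0)) => ->.
  have i10 : (0 <= i + 1)%Z by lia.
  move/(is_rem_mod _ _ (m0 _ i10)) => ->.
  have := rem i' ltac:(lia); rewrite -ei => /(is_rem_mod _ _ (m0 _ i0)) <-.
  have := rem i'.+1 ltac:(lia); rewrite Nat2Z.inj_succ -ei -Z.add_1_r.
  move=> /(is_rem_mod _ _ (m0 _ i10)) <-.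
  by rewrite Z.add_1_r Z.pow_succ_r.
- by rewrite nl; apply: rem.
Qed.

Lemma zdef_is_pow f g : zterm f -> zterm g -> zdef (fun v => is_pow (f v) (g v)).
Proof.
apply: (@def2 _ Zring is_pow); apply: (@def_ext _ Zring _ _ (fun v => beta_powP (v 0) (v 1))).
(* The same condition with nested binary conjunctions, the shape that [defs] takes apart. *)
pose Q (n y : Z) := exists c d : Z,
  (0 <= n)%Z /\ (0 <= d)%Z /\ is_rem c (1 + d) 1 /\
   (forall i r s, (0 <= i)%Z -> (i < n)%Z -> is_rem c (1 + (i + 1) * d) r ->
     is_rem c (1 + (i + 1 + 1) * d) s -> s = (Z.of_nat k * r)%Z)
  /\ is_rem c (1 + (n + 1) * d) y.
apply: (@def_ext _ Zring (fun v => Q (v 0) (v 1))).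
  move=> v; split=> [[c [d [? [? [? [? ?]]]]]]|[c [d [[? ?] ? ? ?]]]]; by exists c, d.
by rewrite /Q; zdefs; apply: zdef_is_rem; zterms.
Qed.

(** Z[1/k] is realised inside the reals, which gives negative powers and the tactics [field] and
    [lra]. *)
Definition kp (j : Z) : R := powerRZ (INR k) j.

Lemma k_neq0 : INR k <> 0%Re.
Proof. by apply: not_0_INR; lia. Qed.

Lemma kp_add i j : kp (i + j) = (kp i * kp j)%Re.
Proof. exact: powerRZ_add k_neq0. Qed.

Lemma kp0 : kp 0 = 1%Re.
Proof. by []. Qed.

Lemma kp_gt0 j : (0 < kp j)%Re.
Proof. by apply: powerRZ_lt; apply: lt_0_INR; lia. Qed.

Lemma kp_neq0 j : kp j <> 0%Re.
Proof. by have := kp_gt0 j; lra. Qed.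

Lemma kp_opp j : kp (- j) = (/ kp j)%Re.
Proof. by apply: powerRZ_neg'. Qed.

Lemma kp_IZR j : (0 <= j)%Z -> kp j = IZR (Z.of_nat k ^ j).
Proof.
move=> j0; rewrite /kp -(Z2Nat.id j j0) -pow_powerRZ INR_IZR_INZ.
by rewrite pow_IZR Z2Nat.id.
Qed.

(** Products and equalities of coded group elements both reduce to this relation between
    integers. *)
Definition lin_kp (m1 j1 m2 j2 m3 j3 : Z) : Prop :=
  (IZR m1 * kp j1 + IZR m2 * kp j2 = IZR m3 * kp j3)%Re.

(* Scaling by a large power of k clears the denominators. *)
Lemma lin_kpP m1 j1 m2 j2 m3 j3 :
  (exists s y1 y2 y3 : Z, is_pow (j1 + s) y1 /\ is_pow (j2 + s) y2 /\
     is_pow (j3 + s) y3 /\ (m1 * y1 + m2 * y2 = m3 * y3)%Z) <->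
  lin_kp m1 j1 m2 j2 m3 j3.
Proof.
rewrite /lin_kp; split=> [[s [y1 [y2 [y3 [[h1 ->] [[h2 ->] [[h3 ->] e]]]]]]]|e].
  apply: (Rmult_eq_reg_r (kp s)); last exact: kp_neq0.
  rewrite Rmult_plus_distr_r !Rmult_assoc -!kp_add !kp_IZR // -!mult_IZR -plus_IZR.
  by rewrite e.
pose s := (Z.abs j1 + Z.abs j2 + Z.abs j3)%Z.
have h1 : (0 <= j1 + s)%Z by rewrite /s; lia.
have h2 : (0 <= j2 + s)%Z by rewrite /s; lia.
have h3 : (0 <= j3 + s)%Z by rewrite /s; lia.
exists s, (Z.of_nat k ^ (j1 + s))%Z, (Z.of_nat k ^ (j2 + s))%Z, (Z.of_nat k ^ (j3 + s))%Z.
split; first by split.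
split; first by split.
split; first by split.
apply: eq_IZR; rewrite plus_IZR !mult_IZR -!kp_IZR // !kp_add -!Rmult_assoc -e.
ring.
Qed.

Lemma zdef_lin_kp f1 f2 f3 f4 f5 f6 :
  zterm f1 -> zterm f2 -> zterm f3 -> zterm f4 -> zterm f5 -> zterm f6 ->
  zdef (fun v => lin_kp (f1 v) (f2 v) (f3 v) (f4 v) (f5 v) (f6 v)).
Proof.
apply: (@def6 _ Zring lin_kp).
apply: (@def_ext _ Zring _ _ (fun v => lin_kpP (v 0) (v 1) (v 2) (v 3) (v 4) (v 5))).
by zdefs; apply: zdef_is_pow; zterms.
Qed.

End Exponentiation.

(** * Divisibility in Z[1/k] *)

Lemma bezout_gcd1 a b u v : (u * a + v * b = 1)%Z -> Z.gcd a b = 1%Z.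
Proof.
move=> e; apply/Znumtheory.Zgcd_1_rel_prime; apply: Znumtheory.bezout_rel_prime.
exact: Znumtheory.Bezout_intro e.
Qed.

Definition is_lcm (w u v : Z) : Prop :=
  (u | w)%Z /\ (v | w)%Z /\ forall t, (u | t)%Z -> (v | t)%Z -> (w | t)%Z.

(** Integers dividing each other agree up to sign, hence the two alternatives. *)
Lemma is_lcm_coprime w u v : Z.gcd u v = 1%Z ->
  is_lcm w u v <-> w = (u * v)%Z \/ w = (- (u * v))%Z.
Proof.
move=> cop.
have mul t : (u | t)%Z -> (v | t)%Z -> (u * v | t)%Z.
  case=> s -> vs; have vs' : (v | s)%Z by apply: (@Z.gauss _ u); rewrite 1?Z.gcd_comm // Z.mul_comm.
  by rewrite (Z.mul_comm s); apply: Z.mul_divide_mono_l.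
split=> [[uw [vw H]]|].
  by apply: Z.divide_antisym; [apply: H; [exists v | exists u]; ring | apply: mul].
case=> ->; rewrite /is_lcm ?Z.divide_opp_r; split; try (by exists v; ring).
  by split; [exists u; ring | exact: mul].
by split=> [|t ut vt]; [exists u; ring | apply/Z.divide_opp_l; apply: mul].
Qed.

(* Julia Robinson's definition of squaring from addition and divisibility;
   the second condition removes the sign ambiguity of the first. *)
Lemma square_via_lcm x z :
  is_lcm (z + x) x (x + 1) /\ is_lcm (z - x) x (x - 1) <-> z = (x * x)%Z.
Proof.
have c1 : Z.gcd x (x + 1) = 1%Z by apply: (@bezout_gcd1 _ _ (-1) 1); ring.
have c2 : Z.gcd x (x - 1) = 1%Z by apply: (@bezout_gcd1 _ _ 1 (-1)); ring.
(* A positive sign in either condition already gives z = x^2; two negative signs force x = 0. *)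
rewrite !is_lcm_coprime //; split; nia.
Qed.

Section LocalizedIntegers.
Variables (k : nat) (k_gt1 : 1 < k).
Notation kp := (kp k).

Definition zk (x : R) : Prop := exists m j : Z, x = (IZR m * kp j)%Re.

Lemma zk_IZR m : zk (IZR m).
Proof. by exists m, 0%Z; rewrite kp0; ring. Qed.

Lemma zk_kp j : zk (kp j).
Proof. by exists 1%Z, j; ring. Qed.

Lemma zk_opp x : zk x -> zk (- x)%Re.
Proof. by case=> m [j ->]; exists (- m)%Z, j; rewrite opp_IZR; ring. Qed.

Lemma zk_mul x y : zk x -> zk y -> zk (x * y)%Re.
Proof.
case=> m [j ->] [m' [j' ->]]; exists (m * m')%Z, (j + j')%Z.
by rewrite mult_IZR kp_add //; ring.
Qed.

Lemma zk_add x y : zk x -> zk y -> zk (x + y)%Re.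
Proof.
case=> m [j ->] [m' [j' ->]].
have [s [h1 h2]] : exists s, (0 <= j + s)%Z /\ (0 <= j' + s)%Z.
  by exists (Z.abs j + Z.abs j')%Z; lia.
exists (m * Z.of_nat k ^ (j + s) + m' * Z.of_nat k ^ (j' + s))%Z, (- s)%Z.
rewrite plus_IZR !mult_IZR -!kp_IZR //.
rewrite !kp_add // kp_opp; have := @kp_neq0 _ k_gt1 s => ?; field.
done.
Qed.

Lemma zk_sub x y : zk x -> zk y -> zk (x - y)%Re.
Proof. by move=> ? ?; apply: zk_add => //; apply: zk_opp. Qed.

Lemma kp_eq1 d : kp d = 1%Re -> d = 0%Z.
Proof.
wlog d0 : d / (0 <= d)%Z => [H e|].
  case: (Z.le_ge_cases 0 d) => h; first exact: H.
  have : kp (- d) = 1%Re by rewrite kp_opp e Rinv_1.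
  by move/(H (- d)%Z ltac:(lia)); lia.
rewrite kp_IZR // => /eq_IZR e; case: (Z.eq_dec d 0) => // dn.
by have /Z.pow_gt_1 := (ltac:(lia) : (1 < Z.of_nat k)%Z) => /(_ d) [/(_ ltac:(lia))]; lia.
Qed.

(** Expansion of (1 + t)^m to second order at t = k^j - 1; negative m is allowed because 1 + t is a
    unit of Z[1/k]. *)
Lemma geometric_second_order j m : exists2 r, zk r &
  (kp (m * j) - 1 = (kp j - 1) * (IZR m + (kp j - 1) * r))%Re.
Proof.
elim/Z.peano_ind: m => [|m [r zr e]|m [r zr e]].
- by exists 0%Re; [exact: (zk_IZR 0) | rewrite Z.mul_0_l kp0; ring].
- exists (IZR m + kp j * r)%Re.
    by apply: zk_add; [exact: zk_IZR | apply: zk_mul => //; exact: zk_kp].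
  rewrite -Z.add_1_r Z.mul_add_distr_r Z.mul_1_l kp_add // plus_IZR.
  have -> : (kp (m * j) = 1 + (kp j - 1) * (IZR m + (kp j - 1) * r))%Re by rewrite -e; ring.
  ring.
- exists ((r - IZR (m - 1)) * kp (- j))%Re.
    by apply: zk_mul; [apply: zk_sub => //; exact: zk_IZR | exact: zk_kp].
  rewrite -Z.sub_1_r Z.mul_sub_distr_r Z.mul_1_l /Z.sub kp_add // kp_opp.
  have -> : (kp (m * j) = 1 + (kp j - 1) * (IZR m + (kp j - 1) * r))%Re by rewrite -e; ring.
  rewrite !plus_IZR opp_IZR; have := @kp_neq0 _ k_gt1 j => ?; field.
  done.
Qed.

(** k^c - 1 is coprime to k, so after clearing the denominator the power of k can be cancelled. *)
Lemma zk_dvd_IZR c t z : (0 < c)%Z -> zk z ->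
  IZR t = ((kp c - 1) * z)%Re -> (Z.of_nat k ^ c - 1 | t)%Z.
Proof.
move=> c0 [m [j ->]] e; set M := (_ - 1)%Z; set K := Z.of_nat k.
have cop : Z.gcd M K = 1%Z.
  apply: (@bezout_gcd1 _ _ (-1) (K ^ (c - 1))).
  have -> : (K ^ (c - 1) * K = K ^ c)%Z.
    by rewrite -{2}(Z.pow_1_r K) -Z.pow_add_r; [congr Z.pow; lia | lia | lia].
  by rewrite /M -/K; ring.
have red s : (0 <= s)%Z -> (M | t * K ^ s)%Z -> (M | t)%Z.
  move: s; apply: natlike_ind => [|s s0 IH]; first by rewrite Z.pow_0_r Z.mul_1_r.
  rewrite Z.pow_succ_r // => H; apply: IH; apply: (@Z.gauss _ K) => //.
  by move: H; congr Z.divide; ring.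
apply: (red (Z.abs j) ltac:(lia)); exists (m * K ^ (j + Z.abs j))%Z; apply: eq_IZR.
rewrite !mult_IZR -!kp_IZR //; [|lia|lia].
rewrite e kp_add // /M minus_IZR -kp_IZR //; last lia.
ring.
Qed.

(** Write d = q c + r. If k^c - 1 divides k^d - 1, it divides k^r - 1, first in Z[1/k] and then in
    Z; as 0 <= k^r - 1 < k^c - 1, this gives r = 0. The converse is the expansion above. *)
Lemma zk_dvd c d : (exists2 z, zk z & (kp d - 1 = (kp c - 1) * z)%Re) <-> (c | d)%Z.
Proof.
split; last first.
  case=> m ->; have [r zr ->] := geometric_second_order c m.
  exists (IZR m + (kp c - 1) * r)%Re => //; apply: zk_add; first exact: zk_IZR.
  by apply: zk_mul => //; apply: zk_sub; [exact: zk_kp | exact: (zk_IZR 1)].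
(* The sign of c is changed by k^(-c) - 1 = -k^(-c) (k^c - 1). *)
wlog c0 : c / (0 <= c)%Z => [H [z zz e]|].
  case: (Z.le_ge_cases 0 c) => h; first by apply: H => //; exists z.
  apply/Z.divide_opp_l; apply: H; first by lia.
  exists (- (kp c * z))%Re; first by apply: zk_opp; apply: zk_mul => //; apply: zk_kp.
  by rewrite e kp_opp; have := @kp_neq0 _ k_gt1 c => ?; field.
case=> z zz e; case: (Z.eq_dec c 0) => [c00|cn].
  have -> : d = 0%Z by apply: kp_eq1; move: e; rewrite c00 kp0; lra.
  exact: Z.divide_0_r.
have dE := Z.div_mod d c cn; have rB := Z.mod_pos_bound d c ltac:(lia).
set r := (d mod c)%Z in dE rB; set q := (d / c)%Z in dE.
have [s zs es] := geometric_second_order c q.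
have er : (kp r - 1 = (kp c - 1) * (z - kp r * (IZR q + (kp c - 1) * s)))%Re.
  have : (kp d - 1 = kp r * (kp (q * c) - 1) + (kp r - 1))%Re.
    by rewrite dE Z.mul_comm kp_add //; ring.
  by rewrite es e => H; ring_simplify; ring_simplify in H; lra.
have zk' : zk (z - kp r * (IZR q + (kp c - 1) * s))%Re.
  apply: zk_sub => //; apply: zk_mul; first exact: zk_kp.
  apply: zk_add; first exact: zk_IZR.
  by apply: zk_mul => //; apply: zk_sub; [exact: zk_kp | exact: (zk_IZR 1)].
have r0 : r = 0%Z.
  have eI : IZR (Z.of_nat k ^ r - 1) = ((kp c - 1) * (z - kp r * (IZR q + (kp c - 1) * s)))%Re.
    by rewrite minus_IZR -kp_IZR //; lia.
  have k1 : (1 < Z.of_nat k)%Z by lia.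
  have lt := Z.pow_lt_mono_r (Z.of_nat k) r c k1 ltac:(lia) ltac:(lia).
  have ge := Z.pow_pos_nonneg (Z.of_nat k) r ltac:(lia) ltac:(lia).
  case: (Z.eq_dec (Z.of_nat k ^ r - 1) 0) => [e0|n0].
    by apply: kp_eq1; rewrite kp_IZR; [congr IZR; lia | lia].
  have dv := zk_dvd_IZR (ltac:(lia) : (0 < c)%Z) zk' eI.
  by have := Z.divide_pos_le _ _ (ltac:(lia) : (0 < Z.of_nat k ^ r - 1)%Z) dv; lia.
by exists q; rewrite {1}dE r0; ring.
Qed.

(** For s = m k^i with m nonzero, take j = |m| + 1: then k^j - 1 > |m| cannot divide m. The index j
    = 0 is exempted, its divisor being 0. *)
Lemma zk_infinitely_divisible s : zk s ->
  (forall j, exists2 z, zk z & (s = (kp j - 1) * z)%Re \/ j = 0%Z) -> s = 0%Re.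
Proof.
case=> m [i ->] H; suff -> : m = 0%Z by ring.
case: (Z.eq_dec m 0) => // mn.
pose j := (Z.abs m + 1)%Z.
have [z zz [|]] := H j; last by rewrite /j; lia.
move=> e; have : IZR m = ((kp j - 1) * (z * kp (- i)))%Re.
  rewrite -Rmult_assoc -e kp_opp; have := @kp_neq0 _ k_gt1 i => ?; field.
  done.
have zz' : zk (z * kp (- i)) by apply: zk_mul => //; apply: zk_kp.
have j0 : (0 < j)%Z by rewrite /j; lia.
move/(zk_dvd_IZR j0 zz') => dv.
have {dv} dv : (Z.of_nat k ^ j - 1 | Z.abs m)%Z by apply/Z.divide_abs_r.
have gt := Z.pow_gt_lin_r (Z.of_nat k) j ltac:(lia) ltac:(lia).
by have := Z.divide_pos_le _ _ (ltac:(lia) : (0 < Z.abs m)%Z) dv; rewrite /j in gt *; lia.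
Qed.

End LocalizedIntegers.

(** * Coordinates on BS(1,k) *)

Notation "x ** y" := (gm x y) (at level 40, left associativity).

Section Groups.
Variables (G : structure Lgroup) (HG : is_group G).
Implicit Types x y z g : G.

Lemma gmA x y z : x ** (y ** z) = x ** y ** z.
Proof. by case: HG => H _; apply: H. Qed.

Lemma g1m x : ge G ** x = x.
Proof. by case: HG => _ [H _]; case: (H x). Qed.

Lemma gm1 x : x ** ge G = x.
Proof. by case: HG => _ [H _]; case: (H x). Qed.

Lemma gVm x : gi x ** x = ge G.
Proof. by case: HG => _ [_ H]; case: (H x). Qed.

Lemma gmV x : x ** gi x = ge G.
Proof. by case: HG => _ [_ H]; case: (H x). Qed.

Lemma gmK x y : x ** y ** gi y = x.
Proof. by rewrite -gmA gmV gm1. Qed.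

Lemma gmVK x y : x ** gi y ** y = x.
Proof. by rewrite -gmA gVm gm1. Qed.

Lemma gm_inj y x z : x ** y = z ** y -> x = z.
Proof. by move=> e; rewrite -(gmK x y) e gmK. Qed.

Lemma gi_unique x y : x ** y = ge G -> x = gi y.
Proof. by move=> e; rewrite -(gmK x y) e g1m. Qed.

Lemma giM x y : gi (x ** y) = gi y ** gi x.
Proof. by symmetry; apply: gi_unique; rewrite gmA gmVK gVm. Qed.

Lemma giK x : gi (gi x) = x.
Proof. by symmetry; apply: gi_unique; rewrite gmV. Qed.

Lemma gi1 : gi (ge G) = ge G.
Proof. by symmetry; apply: gi_unique; rewrite gm1. Qed.

Definition zp (g : G) (n : Z) : G :=
  match n with
  | Z0 => ge G
  | Zpos p => gpow g (Pos.to_nat p)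
  | Zneg p => gi (gpow g (Pos.to_nat p))
  end.

Lemma zp_nat g n : zp g (Z.of_nat n) = gpow g n.
Proof. by case: n => // n; rewrite /= SuccNat2Pos.id_succ. Qed.

Lemma zp_oppn g n : zp g (- Z.of_nat n) = gi (gpow g n).
Proof. by case: n => [|n] /=; rewrite ?gi1 // SuccNat2Pos.id_succ. Qed.

Lemma gpowSr g n : gpow g n.+1 = gpow g n ** g.
Proof.
elim: n => [|n IH]; first by rewrite /= gm1 g1m.
have -> : gpow g n.+2 = g ** gpow g n.+1 by [].
by rewrite [in LHS]IH gmA. Qed.

Lemma zpS g n : zp g (n + 1) = zp g n ** g.
Proof.
case: (Z.le_gt_cases 0 n) => n0.
  have [m ->] : exists m, n = Z.of_nat m by exists (Z.to_nat n); lia.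
  have -> : (Z.of_nat m + 1 = Z.of_nat m.+1)%Z by lia.
  by rewrite !zp_nat gpowSr.
have [m ->] : exists m, n = (- Z.of_nat m.+1)%Z by exists (Z.to_nat (- n)).-1; lia.
have -> : (- Z.of_nat m.+1 + 1 = - Z.of_nat m)%Z by lia.
by rewrite !zp_oppn [gpow g m.+1]/= giM gmVK.
Qed.

Lemma zpD g m n : zp g (m + n) = zp g m ** zp g n.
Proof.
elim/Z.peano_ind: n => [|n IH|n IH]; first by rewrite Z.add_0_r gm1.
  by rewrite -Z.add_1_r Z.add_assoc !zpS IH gmA.
apply: (@gm_inj g); rewrite -gmA -!zpS.
by rewrite -Z.add_assoc !Z.add_1_r Z.succ_pred.
Qed.

Lemma zpN g n : zp g (- n) = gi (zp g n).
Proof. by apply: gi_unique; rewrite -zpD Z.add_opp_diag_l. Qed.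

Lemma zp1 g : zp g 1 = g.
Proof. by rewrite /= gm1. Qed.

Lemma zp_comm g m n : zp g m ** zp g n = zp g n ** zp g m.
Proof. by rewrite -!zpD Z.add_comm. Qed.

Lemma zp_conj g h n : zp (gi h ** g ** h) n = gi h ** zp g n ** h.
Proof.
elim/Z.peano_ind: n => [|n IH|n IH]; first by rewrite /= gm1 gVm.
  by rewrite -Z.add_1_r !zpS IH !gmA; rewrite gmK.
apply: (@gm_inj (gi h ** g ** h)); rewrite -zpS Z.add_1_r Z.succ_pred IH.
have -> : zp g n = zp g (Z.pred n) ** g by rewrite -zpS Z.add_1_r Z.succ_pred.
by rewrite !gmA gmK.
Qed.

Lemma zp_zp g m n : zp (zp g m) n = zp g (m * n).
Proof.
elim/Z.peano_ind: n => [|n IH|n IH]; first by rewrite Z.mul_0_r.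
  by rewrite -Z.add_1_r zpS IH Z.mul_add_distr_l zpD Z.mul_1_r.
apply: (@gm_inj (zp g m)); rewrite -zpS -zpD Z.add_1_r Z.succ_pred IH.
by congr zp; rewrite -Z.sub_1_r; ring.
Qed.

End Groups.

(** * Normal forms and the affine representation *)

Section AffineModel.
Variables (k : nat) (k_gt1 : 1 < k).
Notation kp := (kp k).

(** The first coordinate ranges over all reals; membership in Z[1/k] is recovered from the normal
    form. *)
Definition affine_interp (f : Defs.fsym Lgroup) : ('I_(arity f) -> R * Z) -> R * Z :=
  match f as f0 return ('I_(garity f0) -> R * Z) -> R * Z with
  | gmul => fun s => (((s ord0).1 + kp (- (s ord0).2) * (s ord_max).1)%Re,
                      ((s ord0).2 + (s ord_max).2)%Z)
  | ginv => fun s => ((- (kp (s ord0).2 * (s ord0).1))%Re, (- (s ord0).2)%Z)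
  | gone => fun _ => (0%Re, 0%Z)
  end.

(* The pair (x, n) stands for the affine map t |-> k^(-n) t + x. *)
Definition affine : structure Lgroup := Structure affine_interp.

Lemma affine_mul (x y : affine) : x ** y = ((x.1 + kp (- x.2) * y.1)%Re, (x.2 + y.2)%Z).
Proof. by []. Qed.

Lemma affine_inv (x : affine) : gi x = ((- (kp x.2 * x.1))%Re, (- x.2)%Z).
Proof. by []. Qed.

Lemma affine_one : ge affine = (0%Re, 0%Z).
Proof. by []. Qed.

Lemma affine_group : is_group affine.
Proof.
split; [|split].
- move=> x y z; rewrite !affine_mul /= Z.add_assoc; congr (_, _).
  by rewrite Z.opp_add_distr kp_add //; ring.
- case=> x n; rewrite affine_one !affine_mul /= ?Z.add_0_r.
  by split; congr (_, _); ring.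
- case=> x n; rewrite affine_one !affine_mul !affine_inv /= Z.opp_involutive kp_opp.
  rewrite Z.add_opp_diag_l Z.add_opp_diag_r.
  by have := @kp_neq0 _ k_gt1 n => ?; split; congr (_, _); field.
Qed.

Lemma affine_relation : let c : affine := (1%Re, 0%Z) in let d : affine := (0%Re, 1%Z) in
  gi d ** c ** d = gpow c k.
Proof.
move=> c d; have cn n : gpow c n = (INR n, 0%Z).
  elim: n => [//|n IH]; have -> : gpow c n.+1 = c ** gpow c n by [].
  rewrite IH affine_mul /= -/(INR n.+1) S_INR.
  by congr (_, _); ring.
rewrite cn !affine_mul affine_inv /= /kp /=; congr (_, _); ring.
Qed.

Variables (G : structure Lgroup) (a b : G).
Hypothesis BS : BS_presentation k G a b.

Lemma BS_group : is_group G. Proof. by case: BS. Qed.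
Notation HG := BS_group.

(** The relation a = b a^k b^-1, iterated [s] times. *)
Lemma BS_conj m s : (0 <= s)%Z ->
  zp a m = zp b s ** zp a (m * Z.of_nat k ^ s) ** zp b (- s).
Proof.
move: s; apply: natlike_ind => [|s s0 IH].
  by rewrite /= Z.mul_1_r (gm1 HG) (g1m HG).
have rel n : zp a n = b ** zp a (n * Z.of_nat k) ** gi b.
  have [_ [e _]] := BS; have := zp_conj HG a b n; rewrite e -(zp_nat) (zp_zp HG).
  by rewrite Z.mul_comm => ->; rewrite !(gmA HG) (gmV HG) (g1m HG) (gmK HG).
rewrite IH rel -Z.add_1_r Z.pow_add_r // Z.pow_1_r Z.mul_assoc Z.opp_add_distr.
by rewrite (zpS HG) (Z.add_comm (- s)) (zpD HG b (- (1))) (zpN HG b 1) (zp1 HG) !(gmA HG).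
Qed.

Let E m i l := zp b i ** zp a m ** zp b l.

Lemma BS_normal_form (g : G) : exists m i l, g = E m i l.
Proof.
have lift m i l s : (0 <= s)%Z -> E m i l = E (m * Z.of_nat k ^ s) (i + s) (- s + l).
  by move=> s0; rewrite /E {1}(BS_conj m s0) !(zpD HG) !(gmA HG).
have [_ [_ [gen _]]] := BS; apply: (gen (fun g => exists m i l, g = E m i l)).
- by exists 1%Z, 0%Z, 0%Z; rewrite /E (zp1 HG) /= (gm1 HG) (g1m HG).
- by exists 0%Z, 0%Z, 1%Z; rewrite /E (zp1 HG) /= (gm1 HG) (g1m HG).
- by exists 0%Z, 0%Z, 0%Z; rewrite /E /= !(gm1 HG).
- move=> x y [m [i [l ->]]] [m' [i' [l' ->]]].
  (* Lifting the factors by [s] and [s'] makes the inner powers b^(l - s) and b^(i' + s') cancel. *)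
  have [s [s' [s0 [s0' e]]]] : exists s s',
      (0 <= s)%Z /\ (0 <= s')%Z /\ (- s + l + (i' + s') = 0)%Z.
    by exists (Z.max 0 (l + i')), (Z.max 0 (- (l + i'))); lia.
  exists (m * Z.of_nat k ^ s + m' * Z.of_nat k ^ s')%Z, (i + s)%Z, (- s' + l')%Z.
  rewrite (lift m i l s s0) (lift m' i' l' s' s0') /E; move: (i' + s')%Z (- s + l)%Z e => u v e.
  rewrite !(gmA HG) -(gmA HG _ (zp b v)) -(zpD HG) e /= (gm1 HG).
  by rewrite (zpD HG a) !(gmA HG).
- move=> x [m [i [l ->]]]; exists (- m)%Z, (- l)%Z, (- i)%Z.
  by rewrite /E !(giM HG) !(zpN HG) !(gmA HG).
Qed.

(* (X g, N g) are the coordinates of g in Z[1/k] x| Z. *)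
Lemma BS_coordinates : exists (X : G -> R) (N : G -> Z),
  [/\ (forall g h, X (g ** h) = (X g + kp (- N g) * X h)%Re),
      (forall g h, N (g ** h) = (N g + N h)%Z),
      (forall g h, X g = X h -> N g = N h -> g = h) /\ (forall g, zk k (X g)),
      X a = 1%Re /\ N a = 0%Z & X b = 0%Re /\ N b = 1%Z].
Proof.
have [_ [_ [_ univ]]] := BS.
have [h [hM [ha hb]]] := univ affine _ _ affine_group affine_relation.
have h1 : h (ge G) = ge affine.
  by apply: (@gm_inj _ affine_group (h (ge G))); rewrite -hM (g1m HG) (g1m affine_group).
have hV g : h (gi g) = gi (h g).
  by apply: (gi_unique affine_group); rewrite -hM (gVm HG) h1.
have hzp g n : h (zp g n) = zp (h g) n.
  elim/Z.peano_ind: n => [//|n IH|n IH].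
    by rewrite -Z.add_1_r (zpS HG) (zpS affine_group) hM IH.
  apply: (@gm_inj _ affine_group (h g)); rewrite -hM -(zpS HG) -(zpS affine_group).
  by rewrite Z.add_1_r Z.succ_pred IH.
have zc n : zp ((1%Re, 0%Z) : affine) n = (IZR n, 0%Z).
  elim/Z.peano_ind: n => [//|n IH|n IH].
    rewrite -Z.add_1_r (zpS affine_group) IH affine_mul /= ?kp0 plus_IZR.
    by congr (_, _); ring.
  apply: (@gm_inj _ affine_group (1%Re, 0%Z)); rewrite -(zpS affine_group).
  rewrite Z.add_1_r Z.succ_pred IH affine_mul /=.
  by rewrite -{1}(Z.succ_pred n) succ_IZR; congr (_, _); ring.
have zd n : zp ((0%Re, 1%Z) : affine) n = (0%Re, n).
  elim/Z.peano_ind: n => [//|n IH|n IH].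
    rewrite -Z.add_1_r (zpS affine_group) IH affine_mul /=.
    by congr (_, _); ring.
  apply: (@gm_inj _ affine_group (0%Re, 1%Z)); rewrite -(zpS affine_group).
  rewrite Z.add_1_r Z.succ_pred IH affine_mul /=.
  by congr (_, _); [ring | lia].
have hE m i l : h (E m i l) = ((IZR m * kp (- i))%Re, (i + l)%Z).
  rewrite /E !hM !hzp ha hb zc !zd !affine_mul /=; congr (_, _); first by ring.
  by ring.
(* A normal form with trivial image has m = 0 and i + l = 0. *)
have ker g : h g = ge affine -> g = ge G.
  have [m [i [l ->]]] := BS_normal_form g; rewrite hE => -[e1 e2].
  have m0 : m = 0%Z.
    apply: eq_IZR; apply: (Rmult_eq_reg_r (kp (- i))); last exact: kp_neq0.
    by rewrite e1; ring.
  by rewrite /E m0 /= (gm1 HG) -(zpD HG) e2.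
exists (fun g => (h g).1), (fun g => (h g).2); split.
- by move=> g g'; rewrite hM.
- by move=> g g'; rewrite hM.
- split=> [g g' e1 e2|g].
    rewrite -(giK HG g'); apply: (gi_unique HG); apply: ker.
    rewrite hM hV -[gi (h g')]/(gi (h g')).
    have -> : h g = h g' by case: (h g) (h g') e1 e2 => ? ? [? ?] /= -> ->.
    exact: (gmV affine_group).
  have [m [i [l ->]]] := BS_normal_form g; rewrite hE.
  by exists m, (- i)%Z.
- by rewrite ha.
- by rewrite hb.
Qed.

End AffineModel.

(** * Arithmetic inside the group *)

Section GroupPredicates.
Variables (G : structure Lgroup) (k : nat).
Implicit Types a b c d g h j m n u v w x y z : G.

Definition gcommute x y := x ** y = y ** x.
Definition gcomm x c := gi x ** gi c ** x ** c.

(* For c, d in the centralizer of b: [A, d] is contained in [A, c], where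
   A = C(a) is Z[1/k]; the exponent of c divides the exponent of d. *)
Definition gdiv a c d :=
  forall x, gcommute x a -> exists y, gcommute y a /\ gcomm x d = gcomm y c.

Definition glcm a b w u v := gdiv a u w /\ gdiv a v w /\
  forall t, gcommute t b -> gdiv a u t -> gdiv a v t -> gdiv a w t.

Definition gsquare a b x z :=
  glcm a b (z ** x) x (x ** b) /\ glcm a b (z ** gi x) x (x ** gi b).

(* 2 x y + x^2 + y^2 = (x + y)^2 *)
Definition gprod a b x y z := exists sx sy s,
  (gcommute sx b /\ gcommute sy b /\ gcommute s b) /\
  (gsquare a b x sx /\ gsquare a b y sy /\ gsquare a b (x ** y) s) /\
  z ** z ** (sx ** sy) = s.

(* h = a^m when c = b^m: k^(m j) - 1 = (k^j - 1) m modulo (k^j - 1)^2 for all j. *)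
Definition glog a b c h := gcommute h a /\
  forall j z, gcommute j b -> gcommute z b -> gprod a b c j z ->
  exists y, gcommute y a /\ gcomm a z ** gi (gcomm h j) = gcomm (gcomm y j) j.

Definition gframe a b m j n g := exists h, glog a b m h /\ g = gi j ** h ** j ** n.

(* For BS(1,k) these are the images of the generators under automorphisms. *)
Definition is_frame a b := a <> ge G /\ gi b ** a ** b = gpow a k /\
  forall g, exists m j n, (gcommute m b /\ gcommute j b /\ gcommute n b) /\ gframe a b m j n g.

End GroupPredicates.

(** * Meaning of the group predicates in the coordinates (X, N) *)

Section Coordinates.
Variables (G : structure Lgroup) (HG : is_group G) (N : G -> Z).
Hypothesis NM : forall g h, N (g ** h) = (N g + N h)%Z.

Lemma N1 : N (ge G) = 0%Z.
Proof. by have := NM (ge G) (ge G); rewrite (g1m HG); lia. Qed.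

Lemma NV g : N (gi g) = (- N g)%Z.
Proof. by have := NM g (gi g); rewrite (gmV HG) N1; lia. Qed.

Lemma N_zp g n : N (zp g n) = (n * N g)%Z.
Proof.
elim/Z.peano_ind: n => [|n IH|n IH]; first exact: N1.
  by rewrite -Z.add_1_r (zpS HG) NM IH; ring.
by have := NM (zp g (Z.pred n)) g; rewrite -(zpS HG) Z.add_1_r Z.succ_pred IH; lia.
Qed.

Lemma N_gcomm x c : N (gcomm x c) = 0%Z.
Proof. by rewrite /gcomm !NM !NV; ring. Qed.

Variables (k : nat) (k_gt1 : 1 < k) (X : G -> R).
Notation kp := (kp k).
Hypothesis XM : forall g h, X (g ** h) = (X g + kp (- N g) * X h)%Re.
Hypothesis XN_inj : forall g h, X g = X h -> N g = N h -> g = h.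
Hypothesis X_zk : forall g, zk k (X g).
Hypothesis X_surj : forall x, zk k x -> exists g, X g = x /\ N g = 0%Z.

Lemma X1 : X (ge G) = 0%Re.
Proof. by have := XM (ge G) (ge G); rewrite (g1m HG) N1 /= ?kp0; lra. Qed.

Lemma XV g : X (gi g) = (- (kp (N g) * X g))%Re.
Proof.
have := XM (gi g) g; rewrite (gVm HG) X1 NV Z.opp_involutive; lra.
Qed.

Lemma X_zp g n : N g = 0%Z -> X (zp g n) = (IZR n * X g)%Re.
Proof.
move=> Ng; elim/Z.peano_ind: n => [|n IH|n IH]; first by rewrite X1; ring.
  by rewrite -Z.add_1_r (zpS HG) XM N_zp IH Ng Z.mul_0_r kp0 plus_IZR; ring.
have := XM (zp g (Z.pred n)) g; rewrite -(zpS HG) Z.add_1_r Z.succ_pred IH N_zp Ng Z.mul_0_r kp0.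
by rewrite -{1}(Z.succ_pred n) succ_IZR; lra.
Qed.

Lemma X_conj x g : N x = 0%Z -> X (gi g ** x ** g) = (kp (N g) * X x)%Re.
Proof.
by move=> Nx; rewrite !XM !NM !NV !XV Nx Z.add_0_r !Z.opp_involutive; ring.
Qed.

Lemma X_gcomm x c : N x = 0%Z -> X (gcomm x c) = ((kp (N c) - 1) * X x)%Re.
Proof.
move=> Nx; have -> : gcomm x c = gi x ** (gi c ** x ** c) by rewrite /gcomm !(gmA HG).
by rewrite XM X_conj // XV NV Nx /= ?kp0; ring.
Qed.

Lemma kpV1_neq1 : (1 - kp (-1))%Re <> 0%Re.
Proof. by move=> H; have := @kp_eq1 _ k_gt1 (-1)%Z ltac:(lra). Qed.

(** Applying N to the relation gives N a = k N a, so N a = 0; applying X gives k^(N b) X a = k X a,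
    so N b = 1. *)
Lemma frame_necessary a b : a <> ge G -> gi b ** a ** b = gpow a k ->
  [/\ N a = 0%Z, X a <> 0%Re & N b = 1%Z].
Proof.
move=> a1; rewrite -(zp_nat) => rel.
have Na : N a = 0%Z by have := f_equal N rel; rewrite !NM NV N_zp; nia.
have Xa : X a <> 0%Re by move=> Xa; apply: a1; apply: XN_inj; rewrite ?X1 ?N1.
split=> //; have := f_equal X rel; rewrite X_conj // X_zp // => /(Rmult_eq_reg_r _ _ _) /(_ Xa) e.
have : kp (N b - 1) = 1%Re.
  rewrite /Z.sub kp_add // kp_opp e; have -> : kp 1 = IZR (Z.of_nat k).
    by rewrite kp_IZR // Z.pow_1_r.
  by apply: Rinv_r; apply: IZR_neq; lia.
by move/(kp_eq1 k_gt1); lia.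
Qed.

Section Frame.
Variables (a b : G).
Hypotheses (Na : N a = 0%Z) (Xa : X a <> 0%Re) (Nb : N b = 1%Z).

(** The X-coordinate of b^n: a geometric sum of ratio 1/k, in closed form to cover negative n. *)
Definition centX (n : Z) : R := (X b * (1 - kp (- n)) / (1 - kp (-1)))%Re.

Lemma commute_aP x : gcommute x a <-> N x = 0%Z.
Proof.
split=> [e|Nx].
  have := f_equal X e; rewrite !XM Na /= ?kp0 => e'.
  have : kp (- N x) = 1%Re by apply: (Rmult_eq_reg_r (X a)) => //; lra.
  by move/(kp_eq1 k_gt1); lia.
by apply: XN_inj; rewrite ?XM ?NM Na Nx /= ?kp0; [ring | lia].
Qed.

(** Comparing X of c b and of b c gives a linear equation that determines X c from N c. *)
Lemma commute_bP c : gcommute c b <-> X c = centX (N c).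
Proof.
have K := kpV1_neq1; rewrite /centX; split=> [e|e].
  have := f_equal X e; rewrite !XM Nb => e'.
  apply: (Rmult_eq_reg_r (1 - kp (-1))%Re) => //; field_simplify => //.
  by rewrite [(- (1))%Z]/= in e'; lra.
apply: XN_inj; rewrite ?XM ?NM Nb; last lia.
rewrite [(- (1))%Z]/= e; field.
done.
Qed.

Lemma commute_b_inj c c' : gcommute c b -> gcommute c' b -> N c = N c' -> c = c'.
Proof. by move=> /commute_bP e /commute_bP e' n; apply: XN_inj; rewrite ?e ?e' ?n. Qed.

Lemma commute_bM c c' : gcommute c b -> gcommute c' b -> gcommute (c ** c') b.
Proof. by rewrite /gcommute => e e'; rewrite -(gmA HG) e' (gmA HG) e (gmA HG). Qed.

Lemma commute_zp n : gcommute (zp b n) b.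
Proof. by have := zp_comm HG b n 1; rewrite (zp1 HG). Qed.

Lemma N_zpb n : N (zp b n) = n.
Proof. by rewrite N_zp Nb Z.mul_1_r. Qed.

Lemma zpb_N c : gcommute c b -> zp b (N c) = c.
Proof. by move=> e; apply: commute_b_inj => //; [exact: commute_zp | exact: N_zpb]. Qed.

Lemma X_zpb n : X (zp b n) = centX n.
Proof. by rewrite -{2}(N_zpb n); apply/commute_bP/commute_zp. Qed.

(** On the kernel of N, which is the centralizer of a, the commutator with c multiplies X by k^(N c)
    - 1. Testing at X x = 1 yields divisibility in Z[1/k]. *)
Lemma gdivP c d : gdiv a c d <-> (N c | N d)%Z.
Proof.
rewrite -(zk_dvd k_gt1); split=> [H|[z zz e] x /commute_aP Nx].
  have [x [Xx Nx]] := X_surj (zk_IZR k 1).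
  have [y [/commute_aP Ny e]] := H x (proj2 (commute_aP x) Nx).
  exists (X y) => //; have := f_equal X e; rewrite !X_gcomm // Xx; lra.
have [y [Xy Ny]] := X_surj (zk_mul k_gt1 zz (X_zk x)).
exists y; split; first exact/commute_aP.
by apply: XN_inj; rewrite ?N_gcomm // !X_gcomm // Xy e; ring.
Qed.

Lemma glcmP w u v : glcm a b w u v <-> is_lcm (N w) (N u) (N v).
Proof.
rewrite /glcm /is_lcm !gdivP; split=> -[uw [vw H]]; split=> //; split=> // t.
  by have := H (zp b t) (commute_zp t); rewrite !gdivP N_zpb.
by move=> _; rewrite !gdivP; apply: H.
Qed.

Lemma gsquareP x z : gsquare a b x z <-> N z = (N x * N x)%Z.
Proof. by rewrite /gsquare !glcmP !NM !NV Nb -square_via_lcm. Qed.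

Lemma gprodP x y z : gcommute x b -> gcommute y b -> gcommute z b ->
  gprod a b x y z <-> N z = (N x * N y)%Z.
Proof.
move=> cx cy cz; split=> [[sx [sy [s [_ []]]]]|e].
  by rewrite !gsquareP NM => -[e1 [e2 e3]] /(f_equal N); rewrite !NM; lia.
exists (zp b (N x * N x)), (zp b (N y * N y)), (zp b ((N x + N y) * (N x + N y))).
split; first by do !split; exact: commute_zp.
split; first by rewrite !gsquareP !N_zpb NM.
apply: commute_b_inj; last by rewrite !NM !N_zpb e; ring.
  by do !apply: commute_bM => //; exact: commute_zp.
exact: commute_zp.
Qed.

Lemma X_mulV g h : N g = 0%Z -> N h = 0%Z -> X (g ** gi h) = (X g - X h)%Re.
Proof. by move=> Ng Nh; rewrite XM XV Ng Nh /= ?kp0; ring. Qed.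

(** Put m = N c. Dividing the condition at j by k^j - 1 shows that k^j - 1 divides X h - m X a; this
    for every nonzero j forces X h = m X a. Conversely, the second-order remainder r yields y with X
    y = r X a. *)
Lemma glogP c h : gcommute c b ->
  glog a b c h <-> N h = 0%Z /\ X h = (IZR (N c) * X a)%Re.
Proof.
move=> cc; rewrite /glog commute_aP; split=> -[Nh H]; split=> //.
  suff : (X h - IZR (N c) * X a)%Re = 0%Re by lra.
  apply: (zk_infinitely_divisible k_gt1).
    by apply: zk_sub => //; apply: zk_mul => //; apply: zk_IZR.
  move=> j; have [r zr e] := geometric_second_order k_gt1 j (N c).
  case: (Z.eq_dec j 0) => [j0|jn].
    by exists 0%Re; [exact: (zk_IZR k 0) | right].
  have pr : gprod a b c (zp b j) (zp b (N c * j)).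
    by apply/gprodP; rewrite ?N_zpb //; apply: commute_zp.
  have [y [/commute_aP Ny ey]] := H _ _ (commute_zp _) (commute_zp _) pr.
  exists (r * X a - X y)%Re; first by apply: zk_sub => //; apply: zk_mul.
  left; have := f_equal X ey.
  rewrite X_mulV ?N_gcomm // !X_gcomm ?N_gcomm // !N_zpb e => ex.
  have q1 : (kp j - 1)%Re <> 0%Re.
    by move=> q0; apply: jn; apply: (kp_eq1 k_gt1); lra.
  apply: (Rmult_eq_reg_l (kp j - 1)%Re) => //; lra.
move=> j z cj cz /gprodP e.
have [r zr er] := geometric_second_order k_gt1 (N j) (N c).
have [y [Xy Ny]] := X_surj (zk_mul k_gt1 zr (X_zk a)).
exists y; split; first exact/commute_aP.
apply: XN_inj; last by rewrite NM NV !N_gcomm.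
rewrite X_mulV ?N_gcomm // !X_gcomm ?N_gcomm // (e cc cj cz) er H Xy; ring.
Qed.

Definition frame_elt (m j n : Z) : G := gi (zp b j) ** zp a m ** zp b j ** zp b n.

Lemma N_frame m j n : N (frame_elt m j n) = n.
Proof. by rewrite /frame_elt !NM NV !N_zp Na Nb; ring. Qed.

Lemma X_frame m j n : X (frame_elt m j n) = (X a * (IZR m * kp j) + centX n)%Re.
Proof.
have Nm : N (zp a m) = 0%Z by rewrite N_zp Na Z.mul_0_r.
rewrite /frame_elt XM X_conj // !NM NV Nm !N_zpb X_zpb X_zp //.
have -> : (- (- j + 0 + j))%Z = 0%Z by ring.
rewrite kp0; ring.
Qed.

Lemma gframeP m j n g : gcommute m b -> gcommute j b -> gcommute n b ->
  gframe a b m j n g <-> g = frame_elt (N m) (N j) (N n).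
Proof.
move=> cm cj cn; have Nm : N (zp a (N m)) = 0%Z by rewrite N_zp Na Z.mul_0_r.
have XE h : glog a b m h <-> h = zp a (N m).
  rewrite glogP //; split=> [[Nh Xh]|->]; last by rewrite X_zp.
  by apply: XN_inj; rewrite ?X_zp // Nh Nm.
rewrite /frame_elt !zpb_N //; split=> [[h [/XE -> //]]|->].
by exists (zp a (N m)); split=> //; apply/XE.
Qed.

(** The terms [centX] satisfy a cocycle identity and cancel, and X a divides out. The resulting
    condition does not mention a or b, so one code serves all frames. *)
Lemma frame_elt_mul m1 j1 n1 m2 j2 n2 m3 j3 n3 :
  frame_elt m1 j1 n1 ** frame_elt m2 j2 n2 = frame_elt m3 j3 n3 <->
  (n1 + n2 = n3)%Z /\ lin_kp k m1 j1 m2 (j2 - n1) m3 j3.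
Proof.
have K := kpV1_neq1.
have cD : (centX n1 + kp (- n1) * centX n2 = centX (n1 + n2))%Re.
  by rewrite /centX Z.opp_add_distr kp_add //; field.
rewrite /lin_kp /Z.sub kp_add //; split=> [e|[e1 e2]].
  have e1 : (n1 + n2 = n3)%Z by have := f_equal N e; rewrite NM !N_frame.
  split=> //; have := f_equal X e; rewrite XM !X_frame N_frame -e1 -cD => e2.
  by apply: (Rmult_eq_reg_l (X a)) => //; lra.
apply: XN_inj; last by rewrite NM !N_frame.
rewrite XM !X_frame N_frame -e1 -cD -e2; ring.
Qed.

Lemma frame_elt_eq m j n m' j' n' :
  frame_elt m j n = frame_elt m' j' n' <-> n = n' /\ lin_kp k m j 0 0 m' j'.
Proof.
rewrite /lin_kp; split=> [e|[e1 e2]].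
  have e1 : n = n' by have := f_equal N e; rewrite !N_frame.
  split=> //; have := f_equal X e; rewrite !X_frame e1 => e2.
  by apply: (Rmult_eq_reg_l (X a)) => //; lra.
by apply: XN_inj; rewrite ?N_frame // !X_frame -e2 e1; ring.
Qed.

Lemma frame_elt1 : frame_elt 0 0 0 = ge G.
Proof. by rewrite /frame_elt /= (gi1 HG) !(g1m HG). Qed.

End Frame.

(** Here X b = 0 kills [centX], so decoding is onto because every X g has the form m k^j. *)
Lemma standard_frame a b : N a = 0%Z -> X a = 1%Re -> N b = 1%Z -> X b = 0%Re ->
  gi b ** a ** b = gpow a k -> is_frame k a b.
Proof.
move=> Na Xa Nb Xb rel; have Xa' : X a <> 0%Re by lra.
split; first by move=> e; apply: Xa'; rewrite e X1.
split=> // g; have [m [j e]] := X_zk g.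
exists (zp b m), (zp b j), (zp b (N g)); split; first by do !split; apply: commute_zp.
apply/gframeP => //; try exact: commute_zp.
apply: XN_inj; rewrite ?X_frame ?N_frame ?N_zpb //.
by rewrite Xa e /centX Xb; have := kpV1_neq1 => ?; field.
Qed.

End Coordinates.

(** * Definability in the group language *)

Section GroupDefinability.
Variable G : structure Lgroup.
Implicit Types (f g h : (nat -> G) -> G).

Definition gdef (P : (nat -> G) -> Prop) := definable P.

Lemma gterm_var i : @tdef _ G (fun v => v i).
Proof. exact: tdef_var. Qed.

Lemma gterm_mul f g : tdef f -> tdef g -> tdef (fun v => f v ** g v).
Proof.
case=> t tP [u uP].
exists (@App Lgroup gmul (fun i : 'I_2 => if i == ord0 then t else u)) => v.
rewrite -tP -uP; congr interp; apply: functional_extensionality => i.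
by case: ifP.
Qed.

Lemma gterm_inv f : tdef f -> tdef (fun v => gi (f v)).
Proof.
case=> t tP; exists (@App Lgroup ginv (fun=> t)) => v.
by congr interp; apply: functional_extensionality => i.
Qed.

Lemma gterm1 : tdef (fun _ : nat -> G => ge G).
Proof.
exists (@App Lgroup gone (fun=> Var _ 0)) => v.
by congr interp; apply: functional_extensionality => -[].
Qed.

Lemma gterm_pow f n : tdef f -> tdef (fun v => gpow (f v) n).
Proof. by move=> Df; elim: n => [|n IH]; [exact: gterm1 | exact: gterm_mul]. Qed.

Ltac gterms := repeat first
  [ exact: gterm_var | exact: gterm1 | apply: gterm_pow | apply: gterm_mul | apply: gterm_inv ].
Ltac gdefs := rewrite ?/gdef; defs; repeat (apply: def_eq); try (by gterms).

Lemma gdef_commute f g : tdef f -> tdef g -> gdef (fun v => gcommute (f v) (g v)).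
Proof. by apply: (@def2 _ G (@gcommute G)); rewrite /gcommute; gdefs. Qed.

Lemma gdef_div f g h : tdef f -> tdef g -> tdef h -> gdef (fun v => gdiv (f v) (g v) (h v)).
Proof.
apply: (@def3 _ G (@gdiv G)); by rewrite /gdiv; gdefs; apply: gdef_commute; gterms.
Qed.

Lemma gdef_lcm f1 f2 f3 f4 f5 : tdef f1 -> tdef f2 -> tdef f3 -> tdef f4 -> tdef f5 ->
  gdef (fun v => glcm (f1 v) (f2 v) (f3 v) (f4 v) (f5 v)).
Proof.
apply: (@def5 _ G (@glcm G)); rewrite /glcm; gdefs; try (by apply: gdef_commute; gterms).
all: by apply: gdef_div; gterms.
Qed.

Lemma gdef_square f1 f2 f3 f4 : tdef f1 -> tdef f2 -> tdef f3 -> tdef f4 ->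
  gdef (fun v => gsquare (f1 v) (f2 v) (f3 v) (f4 v)).
Proof.
by apply: (@def4 _ G (@gsquare G)); rewrite /gsquare; gdefs; apply: gdef_lcm; gterms.
Qed.

Lemma gdef_prod f1 f2 f3 f4 f5 : tdef f1 -> tdef f2 -> tdef f3 -> tdef f4 -> tdef f5 ->
  gdef (fun v => gprod (f1 v) (f2 v) (f3 v) (f4 v) (f5 v)).
Proof.
apply: (@def5 _ G (@gprod G)); rewrite /gprod; gdefs; try (by apply: gdef_commute; gterms).
all: by apply: gdef_square; gterms.
Qed.

Lemma gdef_log f1 f2 f3 f4 : tdef f1 -> tdef f2 -> tdef f3 -> tdef f4 ->
  gdef (fun v => glog (f1 v) (f2 v) (f3 v) (f4 v)).
Proof.
apply: (@def4 _ G (@glog G)); rewrite /glog; gdefs; try (by apply: gdef_commute; gterms).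
by apply: gdef_prod; gterms.
Qed.

Lemma gdef_frame f1 f2 f3 f4 f5 f6 :
  tdef f1 -> tdef f2 -> tdef f3 -> tdef f4 -> tdef f5 -> tdef f6 ->
  gdef (fun v => gframe (f1 v) (f2 v) (f3 v) (f4 v) (f5 v) (f6 v)).
Proof.
apply: (@def6 _ G (@gframe G)); rewrite /gframe; gdefs.
by apply: gdef_log; gterms.
Qed.

Lemma gdef_is_frame k : gdef (fun v => is_frame k (v 0) (v 1)).
Proof.
rewrite /is_frame; gdefs; try (by apply: gdef_commute; gterms).
by apply: gdef_frame; gterms.
Qed.

End GroupDefinability.

Section ChosenFormula.
Variables (L : language) (M : structure L).

(** Codes need actual formulas, so one is chosen; only its satisfaction in [M] is known
    afterwards. *)
Definition formula_of (P : (nat -> M) -> Prop) (D : definable P) : formula L :=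
  proj1_sig (constructive_indefinite_description _ D).

Lemma holds_formula_of P (D : definable P) s (R : Prop) : inhabited M ->
  (forall v, P (fun i => nth (v i) s i) <-> R) -> holds M (formula_of D) s <-> R.
Proof.
move=> inhM; apply: holds_iff => // v.
exact: (proj2_sig (constructive_indefinite_description _ D)).
Qed.

End ChosenFormula.

(** * The two interpretations *)

Notation i0 := (@ord0 _).
Notation i1 := (lift ord0 ord0).
Notation i2 := (lift ord0 (lift ord0 ord0)).

Lemma widen0 n : widen_ord (leqnSn n.+1) ord0 = ord0.
Proof. exact: val_inj. Qed.

Lemma widen1 n : widen_ord (leqnSn n.+2) i1 = i1.
Proof. exact: val_inj. Qed.

Lemma ord_max1 : ord_max = i0 :> 'I_1. Proof. exact: val_inj. Qed.
Lemma ord_max2 : ord_max = i1 :> 'I_2. Proof. exact: val_inj. Qed.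
Lemma ord_max3 : ord_max = i2 :> 'I_3. Proof. exact: val_inj. Qed.

Section InterpE.
Variable G : structure Lgroup.

Lemma interp_mul (s : 'I_2 -> G) : interp G (gmul : Defs.fsym Lgroup) s = s i0 ** s i1.
Proof.
congr interp; apply: functional_extensionality => i.
case: eqP => [-> //|ne]; congr s; apply: val_inj.
by case: i ne => -[|[|//]] //= lti ne; case: ne; apply: val_inj.
Qed.

Lemma interp_inv (s : 'I_1 -> G) : interp G (ginv : Defs.fsym Lgroup) s = gi (s i0).
Proof. by congr interp; apply: functional_extensionality => i; rewrite [i]ord1. Qed.

Lemma interp_one (s : 'I_0 -> G) : interp G (gone : Defs.fsym Lgroup) s = ge G.
Proof. by congr interp; apply: functional_extensionality => -[]. Qed.

End InterpE.

Section Codes.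
Variables (k : nat) (k_gt1 : 1 < k) (G : structure Lgroup).

(** The ring language has no subtraction, so j2 - n1 enters as a witness j with j + n1 = j2. *)
Definition frame_mul (m1 j1 n1 m2 j2 n2 m3 j3 n3 : Z) : Prop :=
  (n1 + n2)%Z = n3 /\ exists j, (j + n1)%Z = j2 /\ lin_kp k m1 j1 m2 j m3 j3.

Lemma frame_mulE m1 j1 n1 m2 j2 n2 m3 j3 n3 :
  frame_mul m1 j1 n1 m2 j2 n2 m3 j3 n3 <->
  (n1 + n2 = n3)%Z /\ lin_kp k m1 j1 m2 (j2 - n1) m3 j3.
Proof.
split=> -[e]; last by move=> H; split=> //; exists (j2 - n1)%Z; split=> //; lia.
by case=> j [<-]; rewrite Z.add_simpl_r.
Qed.

Lemma zdef_frame_mul l1 l2 l3 l4 l5 l6 l7 l8 l9 :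
  zdef (fun v => frame_mul (v l1) (v l2) (v l3) (v l4) (v l5) (v l6) (v l7) (v l8) (v l9)).
Proof. by rewrite /frame_mul; zdefs; apply: (zdef_lin_kp k_gt1); zterms. Qed.

Lemma zdef_frame_eq :
  zdef (fun v => v 2 = v 5 /\ lin_kp k (v 0) (v 1) 0 0 (v 3) (v 4)).
Proof. by zdefs; apply: (zdef_lin_kp k_gt1); zterms. Qed.

(** [zdef_frame_mul] speaks of variables only, so 0 is introduced as a bound variable; (0, 0, 0)
    codes the identity. *)
Lemma zdef_frame_inv :
  zdef (fun v => exists z : Z, z = 0%Z /\
    frame_mul (v 0) (v 1) (v 2) (v 3) (v 4) (v 5) z z z).
Proof. by zdefs; apply: zdef_frame_mul. Qed.

Lemma zdef_frame_one :
  zdef (fun v => v 2 = 0%Z /\ lin_kp k (v 0) (v 1) 0 0 0 0).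
Proof. by zdefs; apply: (zdef_lin_kp k_gt1); zterms. Qed.

(* Dimension 3, no parameters: (m, j, n) codes the element b^-j a^m b^j b^n. *)
Definition group_code : code Lgroup Lring :=
  @Code Lgroup Lring 3 0 (formula_of (def_true Zring)) (formula_of zdef_frame_eq)
    (fun f : Defs.fsym Lgroup => match f with
     | gmul => formula_of (zdef_frame_mul 0 1 2 3 4 5 6 7 8)
     | ginv => formula_of zdef_frame_inv
     | gone => formula_of zdef_frame_one
     end).

Lemma group_code_U p t : sU (csem group_code Zring p) t.
Proof.
suff: sU (csem group_code Zring p) t <-> True by case=> _; apply.
by apply: holds_formula_of; first exact: (inhabits 0%Z).
Qed.

(** The coded elements come first, then a and b: these are variables 1 and 2 here, 3 and 4 in
    [gdef_code_mul]. *)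
Lemma gdef_code_U : gdef (fun v : nat -> G => gcommute (v 0) (v 2)).
Proof. by apply: gdef_commute; apply: gterm_var. Qed.

Lemma gdef_code_E : gdef (fun v : nat -> G => v 0 = v 1).
Proof. by apply: def_eq; apply: gterm_var. Qed.

Lemma gdef_code_add : gdef (fun v : nat -> G => v 0 ** v 1 = v 2).
Proof. by apply: def_eq; [apply: gterm_mul; apply: gterm_var | apply: gterm_var]. Qed.

Lemma gdef_code_mul : gdef (fun v : nat -> G => gprod (v 3) (v 4) (v 0) (v 1) (v 2)).
Proof. by apply: gdef_prod; apply: gterm_var. Qed.

Lemma gdef_code_zero : gdef (fun v : nat -> G => v 0 = ge G).
Proof. by apply: def_eq; [apply: gterm_var | apply: gterm1]. Qed.

Lemma gdef_code_one : gdef (fun v : nat -> G => v 0 = v 2).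
Proof. by apply: def_eq; apply: gterm_var. Qed.

(* Dimension 1, parameters (a, b): the centralizer of b, b^n coding n. *)
Definition ring_code : code Lring Lgroup :=
  @Code Lring Lgroup 1 2 (formula_of gdef_code_U) (formula_of gdef_code_E)
    (fun f : Defs.fsym Lring => match f with
     | radd => formula_of gdef_code_add
     | rmul => formula_of gdef_code_mul
     | rzero => formula_of gdef_code_zero
     | rone => formula_of gdef_code_one
     end).

(** Variables 0 to 2 hold the triple, 3 the decoded element, 4 and 5 the parameters a and b. *)
Lemma gdef_thetaA : gdef (fun v : nat -> G =>
  (gcommute (v 0) (v 5) /\ gcommute (v 1) (v 5) /\ gcommute (v 2) (v 5)) /\
  gframe (v 4) (v 5) (v 0) (v 1) (v 2) (v 3)).
Proof.
by rewrite /gdef; defs; try (by apply: gdef_commute; apply: gterm_var);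
   apply: gdef_frame; apply: gterm_var.
Qed.

(* The coded element commutes with the parameter b (variables 7 to 9). *)
Lemma zdef_thetaB : zdef (fun v => (exists w1 w2 w3 : Z,
  frame_mul (v 0) (v 1) (v 2) (v 7) (v 8) (v 9) w1 w2 w3 /\
  frame_mul (v 7) (v 8) (v 9) (v 0) (v 1) (v 2) w1 w2 w3) /\ v 3 = v 2).
Proof. by zdefs; apply: zdef_frame_mul. Qed.

Variables (HG : is_group G) (X : G -> R) (N : G -> Z).
Hypothesis XM : forall g h, X (g ** h) = (X g + kp k (- N g) * X h)%Re.
Hypothesis NM : forall g h, N (g ** h) = (N g + N h)%Z.
Hypothesis XN_inj : forall g h, X g = X h -> N g = N h -> g = h.
Hypothesis X_zk : forall g, zk k (X g).
Hypothesis X_surj : forall x, zk k x -> exists g, X g = x /\ N g = 0%Z.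

Section Frame.
Variables (a b : G).
Hypothesis ab : is_frame k a b.

Let Na : N a = 0%Z.
Proof. by case: ab => a1 [rel _]; case: (frame_necessary HG NM k_gt1 XM XN_inj a1 rel). Qed.
Let Xa : X a <> 0%Re.
Proof. by case: ab => a1 [rel _]; case: (frame_necessary HG NM k_gt1 XM XN_inj a1 rel). Qed.
Let Nb : N b = 1%Z.
Proof. by case: ab => a1 [rel _]; case: (frame_necessary HG NM k_gt1 XM XN_inj a1 rel). Qed.

Definition group_map (t : 'I_3 -> Z) : G := frame_elt a b (t i0) (t i1) (t i2).
Definition ring_map (t : 'I_1 -> G) : Z := N (t i0).

Lemma frame_elt_surj g : exists m j n, g = frame_elt a b m j n.
Proof.
have [_ [_ /(_ g)[m [j [n [[cm [cj cn]] e]]]]]] := ab.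
exists (N m), (N j), (N n).
by apply: (proj1 (gframeP HG NM k_gt1 XM XN_inj X_zk X_surj Na Xa Nb _ cm cj cn)).
Qed.

Lemma group_coord_map (p : 'I_0 -> Z) : is_coord_map (csem group_code Zring p) G group_map.
Proof.
have inhZ : inhabited Zring := inhabits 0%Z.
split; last split.
- move=> g; have [m [j [n ->]]] := frame_elt_surj g.
  by exists (fun i : 'I_3 => nth 0%Z [:: m; j; n] i); split; first exact: group_code_U.
- move=> t t' _ _; rewrite /group_map (frame_elt_eq HG NM k_gt1 XM XN_inj Na Xa Nb).
  rewrite /= !(tseqS, tseq0) /= ?(tseqS, tseq0) /=.
  by apply: holds_formula_of.
- case=> ts _.
  + rewrite interp_mul !widen0 !widen1 ord_max3 /group_map.
    rewrite (frame_elt_mul HG NM k_gt1 XM XN_inj Na Xa Nb) -frame_mulE.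
    rewrite /= !(tseqS, tseq0) /= ?(tseqS, tseq0) /=.
    exact: holds_formula_of.
  + rewrite interp_inv !widen0 ord_max2 /group_map.
    rewrite /= !(tseqS, tseq0) /= ?(tseqS, tseq0) /=; apply: holds_formula_of => // v.
    (* An inverse is recognised by its product with the argument being the identity. *)
    transitivity (frame_elt a b (ts i0 i0) (ts i0 i1) (ts i0 i2) **
       frame_elt a b (ts i1 i0) (ts i1 i1) (ts i1 i2) = frame_elt a b 0 0 0).
      rewrite (frame_elt_mul HG NM k_gt1 XM XN_inj Na Xa Nb) -frame_mulE.
      by split=> [[z [-> //]]|H]; exists 0%Z.
    rewrite frame_elt1 //; split=> [e|<-]; last by rewrite (gmV HG).
    by rewrite -[RHS](giK HG) -(gi_unique HG e).
  + rewrite interp_one ord_max1 /group_map.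
    rewrite /= !(tseqS, tseq0) /= ?(tseqS, tseq0) /=; apply: holds_formula_of => // v.
    rewrite -(frame_elt1 HG a b); split=> [[e H]|/esym].
      by apply/esym/(frame_elt_eq HG NM k_gt1 XM XN_inj Na Xa Nb).
    by move/(frame_elt_eq HG NM k_gt1 XM XN_inj Na Xa Nb).
Qed.

Lemma ring_coord_map (q : 'I_2 -> G) : q i0 = a -> q i1 = b ->
  is_coord_map (csem ring_code G q) Zring ring_map.
Proof.
move=> qa qb; have inhG : inhabited G := inhabits a.
have UE (t : 'I_1 -> G) : sU (csem ring_code G q) t <-> gcommute (t i0) b.
  by rewrite /= !(tseqS, tseq0) /= ?(tseqS, tseq0) /= qb; apply: holds_formula_of.
have inj := commute_b_inj NM k_gt1 XM XN_inj Nb.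
split; last split.
- move=> n; exists (fun=> zp b n); split; first by apply/UE; apply: commute_zp.
  exact: (N_zpb HG NM Nb).
- move=> t t' /UE Ut /UE Ut'; rewrite /ring_map.
  have -> : sE (csem ring_code G q) t t' <-> t i0 = t' i0.
    by rewrite /= !(tseqS, tseq0) /= ?(tseqS, tseq0) /=; apply: holds_formula_of.
  by split=> [-> //|]; apply: inj.
- case=> ts Uts; have {}Uts i := proj1 (UE _) (Uts i).
  + rewrite /= ord_max3 !widen0; have -> : ord_max = i1 :> 'I_2 by apply: val_inj.
    rewrite !widen1 /ring_map -NM !(tseqS, tseq0) /= ?(tseqS, tseq0) /=.
    transitivity (ts i0 i0 ** ts i1 i0 = ts i2 i0); first exact: holds_formula_of.
    by split=> [-> //|]; apply: inj => //; apply: commute_bM.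
  + rewrite /= ord_max3 !widen0; have -> : ord_max = i1 :> 'I_2 by apply: val_inj.
    rewrite !widen1 /ring_map !(tseqS, tseq0) /= ?(tseqS, tseq0) /= qa qb.
    transitivity (gprod a b (ts i0 i0) (ts i1 i0) (ts i2 i0)); first exact: holds_formula_of.
    rewrite (gprodP HG NM k_gt1 XM XN_inj X_zk X_surj Na Xa Nb) //.
    by split=> ->.
  + rewrite /= ord_max1 /ring_map !(tseqS, tseq0) /= ?(tseqS, tseq0) /=.
    transitivity (ts i0 i0 = ge G); first exact: holds_formula_of.
    rewrite -(N1 HG NM); split=> [-> //|/esym]; apply: inj => //.
    by rewrite /gcommute (g1m HG) (gm1 HG).
  + rewrite /= ord_max1 /ring_map !(tseqS, tseq0) /= ?(tseqS, tseq0) /= qb.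
    transitivity (ts i0 i0 = b); first exact: holds_formula_of.
    by rewrite -Nb; split=> [-> //|/esym]; apply: inj.
Qed.

Lemma thetaA_defines (pp : 'I_0 -> 'I_1 -> G) (q : 'I_2 -> G) : q i0 = a -> q i1 = b ->
  @defines_graph _ _ group_code ring_code G (formula_of gdef_thetaA) pp q
    (fun u => group_map (fun i => ring_map (u i))).
Proof.
move=> qa qb u x; have inhG : inhabited G := inhabits a.
have UE (t : 'I_1 -> G) : sU (csem ring_code G q) t <-> gcommute (t i0) b.
  by rewrite /= !(tseqS, tseq0) /= qb; apply: holds_formula_of.
have ppP (i : 'I_0) : sU (csem ring_code G q) (pp i) /\ ring_map (pp i) = ring_map (pp i).
  by case: i.
rewrite (comp_sU (G := group_code) (ring_coord_map qa qb) ppP) /flat.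
transitivity ((gcommute (u i0 i0) b /\ gcommute (u i1 i0) b /\ gcommute (u i2 i0) b) /\
    gframe a b (u i0 i0) (u i1 i0) (u i2 i0) x).
  rewrite /= !(tseqS, tseq0) /= ?(tseqS, tseq0) /= qa qb.
  exact: holds_formula_of.
have fr := gframeP HG NM k_gt1 XM XN_inj X_zk X_surj Na Xa Nb.
split=> [[[c0 [c1 c2]] /fr e]|[[U _] e]].
  split; last exact: e.
  split; last exact: group_code_U.
  move=> i; apply/UE; case: i => -[|[|[|//]]] lti.
  - by have -> : Ordinal lti = i0 by apply: val_inj.
  - by have -> : Ordinal lti = i1 by apply: val_inj.
  - by have -> : Ordinal lti = i2 by apply: val_inj.
have c0 := proj1 (UE _) (U i0); have c1 := proj1 (UE _) (U i1).
have c2 := proj1 (UE _) (U i2).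
by do !split=> //; apply/fr.
Qed.

End Frame.

Section FrameChange.
Variables (a b c d : G).
Hypothesis cd : is_frame k c d.

(** The frame (c, d) decodes triples into group elements, and [qq] codes a and b. The composite
    returns the third entry by [N_frame]; its domain condition, commuting with b, says that the two
    products have a common code. *)
Lemma thetaB_defines (qq : 'I_2 -> 'I_3 -> Z) (p : 'I_0 -> Z) :
  group_map c d (qq i0) = a -> group_map c d (qq i1) = b ->
  @defines_graph _ _ ring_code group_code Zring (formula_of zdef_thetaB) qq p
    (fun u => ring_map (fun i => group_map c d (u i))).
Proof.
move=> qa qb u x; have inhZ : inhabited Zring := inhabits 0%Z.
have [c1 [rel _]] := cd.
have [Nc Xc Nd] := frame_necessary HG NM k_gt1 XM XN_inj c1 rel.
have mulE := frame_elt_mul HG NM k_gt1 XM XN_inj Nc Xc Nd.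
have qqP (i : 'I_2) : sU (csem group_code Zring p) (qq i) /\
    group_map c d (qq i) = group_map c d (qq i) by split; first exact: group_code_U.
rewrite (comp_sU (G := ring_code) (group_coord_map cd p) qqP) /flat.
set U := sU _ _.
have -> : U <-> gcommute (group_map c d (u i0)) b.
  rewrite /U /= !(tseqS, tseq0) /= qb.
  by apply: holds_formula_of; first exact: (inhabits a).
have -> : ring_map (fun i => group_map c d (u i)) = u i0 i2.
  by rewrite /ring_map /group_map (N_frame HG NM Nc Nd).
transitivity ((exists w1 w2 w3 : Z,
    frame_mul (u i0 i0) (u i0 i1) (u i0 i2) (qq i1 i0) (qq i1 i1) (qq i1 i2) w1 w2 w3 /\
    frame_mul (qq i1 i0) (qq i1 i1) (qq i1 i2) (u i0 i0) (u i0 i1) (u i0 i2) w1 w2 w3)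
    /\ x = u i0 i2).
  rewrite /= !(tseqS, tseq0) /= ?(tseqS, tseq0) /=.
  exact: holds_formula_of.
split=> [[[w1 [w2 [w3]]]]|].
  rewrite !frame_mulE -!mulE => -[e1 e2] ->; split=> //.
  split; first by move=> i; exact: group_code_U.
  by rewrite /gcommute -qb /group_map e1 e2.
case=> [[_ e]] ->; split=> //.
(* A code of the common product exists since decoding by the frame (c, d) is onto. *)
have [w1 [w2 [w3 ew]]] := frame_elt_surj cd (group_map c d (u i0) ** b).
exists w1, w2, w3; rewrite !frame_mulE -!mulE; split.
  by rewrite -ew -qb.
by rewrite -ew e -qb.
Qed.

End FrameChange.

Variables (a b : G).
Hypothesis ab : is_frame k a b.

Lemma biinterpretable : strongly_regularly_biinterpretable G Zring.
Proof.
have inhG : inhabited G := inhabits (ge G); have inhZ : inhabited Zring := inhabits 0%Z.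
have psiP (q : 'I_2 -> G) : holds G (formula_of (gdef_is_frame G k)) (tseq q) <->
    is_frame k (q i0) (q i1).
  by rewrite !(tseqS, tseq0); apply: holds_formula_of.
have p0 : 'I_0 -> Z by case.
pose q0 (i : 'I_2) := nth a [:: a; b] i.
exists group_code, (formula_of (def_true Zring)), ring_code,
  (formula_of (gdef_is_frame G k)), (formula_of gdef_thetaA), (formula_of zdef_thetaB).
split; [|split; [|split; [|split]]].
- split=> [|p _]; last by exists (group_map a b); apply: group_coord_map.
  by exists p0; apply: (proj2 (holds_formula_of (def_true Zring) (R := True) inhZ _)).
- split=> [|q /psiP fr]; last by exists ring_map; apply: (ring_coord_map fr).
  by exists q0; apply/psiP.
- move=> pp q [_ /psiP fr]; have cmD := ring_coord_map fr erefl erefl.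
  exists (fun u => group_map (q i0) (q i1) (fun i => ring_map (u i))); split.
    have cmG := group_coord_map fr (fun i => ring_map (pp i)).
    by apply: (comp_coord_map cmG cmD); case.
  exact: thetaA_defines.
(* Decoding uses the fixed frame (a, b); the pair coded by [qq] is a possibly different frame q,
   which supplies the copy of Z. *)
- move=> qq p [fr _]; have cmG := group_coord_map ab p.
  pose q i := group_map a b (qq i).
  have {}fr : is_frame k (q i0) (q i1).
    apply/psiP; have := fr; rewrite (holdsT_holds cmG) => -[_].
    by rewrite tseq_map.
  have cmD := ring_coord_map fr erefl erefl.
  exists (fun u => ring_map (fun i => group_map a b (u i))); split.
    apply: (comp_coord_map cmD cmG) => i; split=> //; exact: group_code_U.
  by apply: (thetaB_defines ab).
(* Both coordinate maps are now built on the given frame q, and [qq] codes q with respect to q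
   itself. *)
- move=> p q _ /psiP fr; exists (group_map (q i0) (q i1)), ring_map.
  split; first exact: group_coord_map.
  split; first exact: (ring_coord_map fr).
  split=> [pp _|qq qqP]; first exact: thetaA_defines.
  by apply: (thetaB_defines fr); [have [] := qqP i0 | have [] := qqP i1].
Qed.

End Codes.

Theorem theorem4p7 (k : nat) (hk : 1 < k) (G : structure Lgroup) (a b : G) :
  BS_presentation k G a b ->
  strongly_regularly_biinterpretable G Zring.
Proof.
move=> BS; have HG := BS_group BS.
have [X [N [XM NM [XN_inj X_zk] [Xa Na] [Xb Nb]]]] := BS_coordinates hk BS.
have X_surj x : zk k x -> exists g, X g = x /\ N g = 0%Z.
  (* b^-j a^m b^j has coordinates X = m k^j and N = 0. *)
  move=> [m [j ->]]; exists (gi (zp b j) ** zp a m ** zp b j).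
  have Nm : N (zp a m) = 0%Z by rewrite (N_zp HG NM) Na Z.mul_0_r.
  rewrite (X_conj HG NM XM) // (X_zp HG NM XM) // Xa !NM (NV HG NM) Nm.
  by rewrite !(N_zp HG NM) Nb; split; [rewrite Z.mul_1_r; ring | ring].
apply: (biinterpretable hk HG XM NM XN_inj X_zk X_surj (a := a) (b := b)).
apply: (standard_frame HG NM hk XM XN_inj X_zk X_surj Na Xa Nb Xb).
by case: BS => _ [].
Qed.
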